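(* Fix $2<p<\infty$, let $q=p/(p-1)$, and let $L,R>0$, $\varepsilon>0$. (i) There are a deterministic method (knowing $L,R,p,\varepsilon$) and a constant $C_p$ depending only on $p$ (in particular not on the dimension $d$) such that, for every admissible objective $f:\mathbb R^d\to\mathbb R$ with $\operatorname{dist}_p(x_0,X^* )\le R$, the method returns a queried point $\widehat x$ with $\|\nabla f(\widehat x)\|_q\le\varepsilon$ using at most $$C_p\left(1+\left(\frac{LR}{\varepsilon}\right)^{p/(p+2)}\right)$$ pair-oracle calls. (ii) There are a universal constant $C$ and numbers $M_{p,d}>0$ depending only on $p,d$ with $M_{p,d}\le C\min\{p,\ln d\}$ such that, for every $d\ge2$, every integer $1\le T\le d$, and every deterministic exact-pair algorithm, there is an admissible objective $f:\mathbb R^d\to\mathbb R$ with $\operatorname{dist}_p(x_0,X^* )=R$ such that every one of the algorithm's first $T$ queries $x_t$ satisfies $$\|\nabla f(x_t)\|_q\ge\frac{LR}{512\,M_{p,d}\,T^{1+2/p}}.$$ Consequently, whenever the integer horizon selected by solving this inequality for $T$ (the largest integer $T\ge 1$ for which the right-hand side exceeds $\varepsilon$) is at most $d$, the number of queries needed by any deterministic exact-pair algorithm to query a point with $\|\nabla f\|_q\le\varepsilon$ is, in the worst case over admissible objectives with $\operatorname{dist}_p(x_0,X^* )=R$, bounded below by $$\Omega\left(\left[\frac{LR}{\varepsilon\min\{p,\ln d\}}\right]^{p/(p+2)}\right)$$ with a universal implied constant. For fixed $p$, if $d$ is large enough that the selected horizon is at most $d$ and $p\le3\ln d$, the upper and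 lower bounds have the same polynomial exponent $p/(p+2)$ in $K=LR/\varepsilon$.
   Context: An admissible objective is a differentiable convex function $f:\mathbb R^d\to\mathbb R$ with nonempty minimizer set $X^*:=\operatorname{argmin} f$ satisfying $\|\nabla f(x)-\nabla f(y)\|_q\le L\|x-y\|_p$ for all $x,y\in\mathbb R^d$. $\operatorname{dist}_p(x_0,X^* )=\inf_{x\in X^*}\|x_0-x\|_p$. Oracle model: $L,R,p,\varepsilon$ are known to the algorithm. One oracle call at $x$ returns the exact pair $(f(x),\nabla f(x))$. The prescribed point $x_0$ is the first query and is charged; subsequent queries may be arbitrary deterministic functions of the preceding pairs; the output must be a point that was queried. A deterministic exact-pair algorithm is any algorithm of this kind. *)

(* Defs.v *)
From HB Require Import structures.
From mathcomp Require Import all_boot all_order all_algebra.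
From mathcomp Require Import all_classical all_reals all_analysis.
Set Implicit Arguments.
Unset Strict Implicit.
Unset Printing Implicit Defensive.
Import Order.TTheory GRing.Theory Num.Theory.
Import numFieldNormedType.Exports.
Local Open Scope classical_set_scope.
Local Open Scope ring_scope.

Definition lpnorm {R : realType} {d : nat} (p : R) (x : 'rV[R]_d) : R :=
  (\sum_(i < d) `|x 0 i| `^ p) `^ p^-1.

Definition gradient {R : realType} {d : nat} (f : 'rV[R]_d -> R)
    (x : 'rV[R]_d) : 'rV[R]_d :=
  \row_(i < d) 'D_(delta_mx 0 i) f x.

Definition argmin {R : realType} {d : nat} (f : 'rV[R]_d -> R) :
    set 'rV[R]_d :=
  [set x | forall y, f x <= f y].

(* [inf] is the infimum in R, equal to 0 on the empty set; it is only used
   with a nonempty [X]. *)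
Definition lpdist {R : realType} {d : nat} (p : R) (x : 'rV[R]_d)
    (X : set 'rV[R]_d) : R :=
  inf [set lpnorm p (x - y) | y in X].

Definition conjugate_exponent {R : realType} (p : R) : R := p / (p - 1).

(* The topology of 'rV[R]_d is that of the sup norm, hence the usual one, and
   [differentiable] is Fréchet differentiability. *)
Definition admissible {R : realType} {d : nat} (p L : R)
    (f : 'rV[R]_d -> R) : Prop :=
  [/\ forall x, differentiable f x,
      convex_function [set: 'rV[R]_d] f,
      argmin f !=set0
    & forall x y,
        lpnorm (conjugate_exponent p) (gradient f x - gradient f y)
          <= L * lpnorm p (x - y)].

Definition oracle {R : realType} {d : nat} (f : 'rV[R]_d -> R)
    (x : 'rV[R]_d) : R * 'rV[R]_d :=
  (f x, gradient f x).

(* Given the list [h] of the pairs received so far, oldest first, the algorithm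
   either queries a new point ([inl]) or stops and outputs the point of the
   query number [i < size h] ([inr i]).  The points already queried are
   themselves functions of [h], so they need not be passed along. *)
Record algorithm {R : realType} {d : nat} (x0 : 'rV[R]_d) : Type := Algorithm {
  step :> forall h : seq (R * 'rV[R]_d), 'rV[R]_d + 'I_(size h);
  step_nil : step [::] = inl x0
}.

(* The first [n] queries made on [f], in order; there are fewer than [n] of them
   if the algorithm stops earlier. *)
Fixpoint queries {R : realType} {d : nat} {x0 : 'rV[R]_d} (A : algorithm x0)
    (f : 'rV[R]_d -> R) (n : nat) : seq 'rV[R]_d :=
  if n is m.+1 then
    let s := queries A f m in
    match A (map (oracle f) s) with
    | inl x => rcons s x
    | inr _ => s
    end
  else [::].

(* On [f], the algorithm stops after exactly [n] oracle calls and outputs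
   [xhat]. *)
Definition returns {R : realType} {d : nat} {x0 : 'rV[R]_d} (A : algorithm x0)
    (f : 'rV[R]_d -> R) (n : nat) (xhat : 'rV[R]_d) : Prop :=
  let s := queries A f n in
  size s = n /\
  exists i : 'I_(size (map (oracle f) s)),
    A (map (oracle f) s) = inr i /\ xhat = nth 0 s i.

(* +oo when no [eps]-stationary point is ever queried. *)
Definition queries_needed {R : realType} {d : nat} {x0 : 'rV[R]_d}
    (A : algorithm x0) (p eps : R) (f : 'rV[R]_d -> R) : \bar R :=
  ereal_inf [set n%:R%:E | n in [set n : nat |
    exists2 x, x \in queries A f n &
      lpnorm (conjugate_exponent p) (gradient f x) <= eps]].

Definition worst_case {R : realType} {d : nat} {x0 : 'rV[R]_d}
    (A : algorithm x0) (p eps : R) (F : set ('rV[R]_d -> R)) : \bar R :=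
  ereal_sup [set queries_needed A p eps f | f in F].

Definition complexity {R : realType} {d : nat} (x0 : 'rV[R]_d) (p eps : R)
    (F : set ('rV[R]_d -> R)) : \bar R :=
  ereal_inf [set worst_case A p eps F | A in [set: algorithm x0]].

Definition objectives_eq {R : realType} {d : nat} (p L r : R)
    (x0 : 'rV[R]_d) : set ('rV[R]_d -> R) :=
  [set f | admissible p L f /\ lpdist p x0 (argmin f) = r].

Definition objectives_le {R : realType} {d : nat} (p L r : R)
    (x0 : 'rV[R]_d) : set ('rV[R]_d -> R) :=
  [set f | admissible p L f /\ lpdist p x0 (argmin f) <= r].

Definition gradient_floor {R : realType} (m p L r : R) (T : nat) : R :=
  L * r / (512 * m * T%:R `^ (1 + 2 / p)).

(* [T] is the largest positive integer whose gradient floor exceeds [eps]. *)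
Definition selected_horizon {R : realType} (m p L r eps : R) (T : nat) : Prop :=
  [/\ (1 <= T)%N,
      eps < gradient_floor m p L r T
    & forall n : nat, (1 <= n)%N -> eps < gradient_floor m p L r n ->
        (n <= T)%N].

(* Main.v *)
Require Import Defs.
From HB Require Import structures.
From mathcomp Require Import all_boot all_order all_algebra.
From mathcomp Require Import ring lra zify.
From mathcomp Require Import all_classical all_reals all_analysis.
Import Order.TTheory GRing.Theory Num.Theory.
Import numFieldNormedType.Exports.
Local Open Scope classical_set_scope.
Local Open Scope ring_scope.
Set Implicit Arguments.
Unset Strict Implicit.
Unset Printing Implicit Defensive.

(** Upper bound. For p > 2 the sum N of the p-th powers of the coordinates is
    uniformly convex of degree p with a constant that does not depend on the
    dimension ([clarkson]), so it can be the prox term of an accelerated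
    method. On f + G with G known, the method started at distance at most D
    from a point reaches in T queries a value within L D^2 / T^(1+2/p) of the
    value there, up to a factor depending on p ([one_stage]).

    This controls values; gradients need successive regularizations. Stage s
    adds l_s N(x - c_s) to the objective, where c_s is the current point, and
    minimizes the result just well enough for uniform convexity to divide by 4
    the distance D_s to its minimizer ([stage_contracts]). At the minimizer of
    the regularized function the gradient of f balances that of the
    regularizer, so that its dual norm is at most of the order of the sum of
    the l_s D_s^(p-1) ([gradient_at_regularized_min]). If l_s D_s^(p-1) is
    proportional to eps / 2^s, this sum is at most eps / 2, whereas stage s
    costs about (2^s L D_s / eps)^(p/(p+2)) queries with D_s = 2 R / 4^s. The
    costs decrease geometrically, hence the first stage dominates and no
    logarithm appears ([stages_trace], [upper_bound]).

    Lower bound. The hard functions are smoothed maxima of signed and shifted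
    coordinates: the maximum over the weights l >= 0 of total mass at most 1
    of <l, y> minus c times the sum of the l_i^q, where y_j is
    xi_j (x - x0)_j + h_j and q is conjugate to some s >= 2. The maximizing
    weights are the gradient up to signs and scale, and they are Lipschitz in
    y with a constant of order (s - 1) / c, because the penalty is strongly
    convex on the simplex in the l_q norm ([smax_arg_lip]). The choice
    s = min(p, max(2, ln d)) turns this into a constant of order min(p, ln d)
    ([hard_exponent_norm], [hard_exponent_le]).

    The smoothing is exactly local: a coordinate of y that is more than c q
    below another one has weight 0 ([smax_arg_eq0]). An adversary can thus
    reveal one coordinate per query, the unused one where the query is
    farthest from x0, with the sign that makes it count; decreasing shifts
    h_j hide the coordinates revealed later, so earlier answers remain valid
    ([covers_oracle], [adversary]). At each query the weights have total mass
    1 and live on at most T coordinates, and Hölder's inequality bounds the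
    dual norm of the gradient from below ([gradient_lower_bound]). The
    minimizers are the points with y <= 0, at distance the l_p norm of h,
    which can be prescribed exactly ([hard_lpdist]). *)

(** * Real powers and the norms *)

Section scalar_powers.
Variable R : realType.
Implicit Types (a b p r t x y : R).

Lemma powR_half_even x p : `|x| `^ p = (x ^+ 2) `^ (p / 2).
Proof.
rewrite -(real_normK (num_real x)) -powR_mulrn// -powRrM.
by congr powR; field.
Qed.

(** Young's inequality for the product of a^(p-1) and b, rearranged. *)
Lemma powR_tangent p a b : 1 <= p -> 0 <= a -> 0 <= b ->
  a `^ p + p * a `^ (p - 1) * (b - a) <= b `^ p.
Proof.
move=> p1 a0 b0; have p0 : 0 < p by lra.
have aE : a * a `^ (p - 1) = a `^ p by rewrite mulr_powRB1.
move: p1; rewrite le_eqVlt => /orP[/eqP<-|p1].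
  by rewrite subrr powRr0 !powRr1//; lra.
have q0 : 0 < p / (p - 1) by rewrite divr_gt0//; lra.
have := @conjugate_powR _ b (a `^ (p - 1)) p (p / (p - 1)) b0 (powR_ge0 _ _) p0 q0.
have -> : p^-1 + (p / (p - 1))^-1 = 1 by field; apply/andP; split; lra.
rewrite -powRrM; have -> : (p - 1) * (p / (p - 1)) = p by field; lra.
move=> /(_ erefl); rewrite -(ler_pM2l p0) mulrDr.
have -> : p * (b `^ p / p) = b `^ p by field; lra.
have -> : p * (a `^ p / (p / (p - 1))) = (p - 1) * a `^ p.
  by field; apply/andP; split; lra.
rewrite -aE; nra.
Qed.

(** The weighted arithmetic-geometric mean inequality for b^r a^(1-r), divided
    by a^(1-r). *)
Lemma powR_concave_tangent r a b : 0 < r <= 1 -> 0 < a -> 0 <= b ->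
  r * a `^ (r - 1) * (a - b) <= a `^ r - b `^ r.
Proof.
move=> /andP[r0 r1] a0 b0.
have aE : a * a `^ (r - 1) = a `^ r by rewrite mulr_powRB1// ltW.
move: r1; rewrite le_eqVlt => /orP[/eqP->|r1].
  by rewrite subrr powRr0 !powRr1//; lra.
have i0 : 0 < r^-1 by rewrite invr_gt0.
have j0 : 0 < (1 - r)^-1 by rewrite invr_gt0; lra.
have := @conjugate_powR _ (b `^ r) (a `^ (1 - r)) _ _ (powR_ge0 _ _) (powR_ge0 _ _) i0 j0.
have r0' : r != 0 by lra.
have r1' : 1 - r != 0 by lra.
rewrite !invrK -!powRrM !divff// !powRr1 ?(ltW a0)//.
move=> /(_ ltac:(lra)) h.
have k0 : 0 < a `^ (r - 1) by exact: powR_gt0.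
have kk : a `^ (1 - r) * a `^ (r - 1) = 1.
  rewrite -powRD ?(gt_eqF a0) ?implybT//.
  have -> : 1 - r + (r - 1) = 0 by lra.
  by rewrite powRr0.
move: h; rewrite -(ler_pM2r k0) -[X in X <= _]mulrA kk mulr1; nra.
Qed.

(** Replacing the factors a^(t-1) and b^(t-1) by (a+b)^(t-1) only increases
    the sum. *)
Lemma powR_superadd t a b : 1 <= t -> 0 <= a -> 0 <= b ->
  a `^ t + b `^ t <= (a + b) `^ t.
Proof.
move=> t1 a0 b0; have t0 : 0 < t by lra.
rewrite -(mulr_powRB1 a0 t0) -(mulr_powRB1 b0 t0) -(mulr_powRB1 (addr_ge0 a0 b0) t0).
rewrite mulrDl lerD// ler_wpM2l// ge0_ler_powR ?nnegrE//; lra.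
Qed.

Lemma powR_convex p (th : R) a b : 1 <= p -> 0 <= th <= 1 -> 0 <= a -> 0 <= b ->
  (th * a + (1 - th) * b) `^ p <= th * a `^ p + (1 - th) * b `^ p.
Proof.
move=> p1 /andP[t0 t1] a0 b0; set m := _ + _.
have m0 : 0 <= m by rewrite addr_ge0// mulr_ge0//; lra.
have := powR_tangent p1 m0 a0; have := powR_tangent p1 m0 b0.
set k := p * _ => hb ha.
have h1 : 0 <= 1 - th by lra.
have : th * (m `^ p + k * (a - m)) + (1 - th) * (m `^ p + k * (b - m)) = m `^ p.
  by rewrite /m; ring.
by move=> <-; rewrite lerD// ler_wpM2l.
Qed.

Lemma norm_powR_convex p (th : R) a b : 1 <= p -> 0 <= th <= 1 ->
  `|th * a + (1 - th) * b| `^ p <= th * `|a| `^ p + (1 - th) * `|b| `^ p.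
Proof.
move=> p1 t01; apply: le_trans (powR_convex p1 t01 (normr_ge0 a) (normr_ge0 b)).
move: t01 => /andP[t0 t1].
have h1 : 0 <= 1 - th by lra.
rewrite ge0_ler_powR ?nnegrE ?addr_ge0 ?mulr_ge0//; first lra.
by rewrite (le_trans (ler_normD _ _))// !normrM (ger0_norm t0) (ger0_norm h1).
Qed.

(** The squares of (a+b)/2 and (a-b)/2 add up to (a^2+b^2)/2: superadditivity
    of t^(p/2) merges them, and convexity of t^(p/2) splits the mean. *)
Lemma clarkson_scalar p a b : 2 <= p ->
  `|(a + b) / 2| `^ p + `|(a - b) / 2| `^ p <= (`|a| `^ p + `|b| `^ p) / 2.
Proof.
move=> p2; have t1 : 1 <= p / 2 by lra.
rewrite !powR_half_even.
apply: le_trans (powR_superadd t1 (sqr_ge0 _) (sqr_ge0 _)) _.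
have -> : ((a + b) / 2) ^+ 2 + ((a - b) / 2) ^+ 2 = 2^-1 * a ^+ 2 + (1 - 2^-1) * b ^+ 2 by field.
apply: le_trans (powR_convex t1 _ (sqr_ge0 _) (sqr_ge0 _)) _; lra.
Qed.

Lemma powRK x p : 0 <= x -> p != 0 -> (x `^ p) `^ p^-1 = x.
Proof. by move=> x0 p0; rewrite -powRrM divff// powRr1. Qed.

Lemma powRVK x p : 0 <= x -> p != 0 -> (x `^ p^-1) `^ p = x.
Proof. by move=> x0 p0; rewrite -powRrM mulVf// powRr1. Qed.

Lemma ler_powR2 x y p : 0 < p -> 0 <= x -> 0 <= y -> (x `^ p <= y `^ p) = (x <= y).
Proof.
move=> p0 x0 y0; apply/idP/idP => [|xy]; last by rewrite ge0_ler_powR ?nnegrE// ltW.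
by apply: contraTT; rewrite -!ltNge => yx; rewrite gt0_ltr_powR ?nnegrE.
Qed.

Lemma continuous_norm_powR p : 0 < p -> continuous (fun x : R => `|x| `^ p).
Proof.
move=> p0 x; have [->|x0] := eqVneq x 0.
  apply/cvgrPdist_lt => e e0; near=> y.
  rewrite normr0 powR0 ?gt_eqF// sub0r normrN ger0_norm ?powR_ge0//.
  rewrite -(powRVK (ltW e0) (lt0r_neq0 p0)) gt0_ltr_powR ?nnegrE ?powR_ge0//.
  near: y; exists (e `^ p^-1); [exact: powR_gt0 | by move=> z /=; rewrite sub0r normrN].
have h : {for `|x|, continuous (fun y : R => y `^ p)}.
  apply/differentiable_continuous/derivable1_diffP/derivable_powR.
  by rewrite in_itv /= andbT normr_gt0.
by apply: (@continuous_comp _ _ _ (@Num.norm R R) (fun y : R => y `^ p)); [exact: norm_continuous | exact: h].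
Unshelve. all: by end_near.
Qed.

End scalar_powers.

Section norms.
Variables (R : realType) (d : nat).
Implicit Types (x y u v g : 'rV[R]_d) (p q : R).

Definition dotr g x : R := \sum_(i < d) g 0 i * x 0 i.
Definition powsum p x : R := \sum_(i < d) `|x 0 i| `^ p.

Lemma dotrC g x : dotr g x = dotr x g.
Proof. by apply: eq_bigr => i _; rewrite mulrC. Qed.
Lemma dotrDr g x y : dotr g (x + y) = dotr g x + dotr g y.
Proof. by rewrite -big_split; apply: eq_bigr => i _; rewrite mxE mulrDr. Qed.
Lemma dotrZr g a x : dotr g (a *: x) = a * dotr g x.
Proof. by rewrite mulr_sumr; apply: eq_bigr => i _; rewrite mxE; ring. Qed.
Lemma dotrNr g x : dotr g (- x) = - dotr g x.
Proof. by rewrite -scaleN1r dotrZr mulN1r. Qed.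
Lemma dotrBr g x y : dotr g (x - y) = dotr g x - dotr g y.
Proof. by rewrite dotrDr dotrNr. Qed.
Lemma dotrDl g x y : dotr (x + y) g = dotr x g + dotr y g.
Proof. by rewrite !(dotrC _ g) dotrDr. Qed.
Lemma dotrZl g a x : dotr (a *: x) g = a * dotr x g.
Proof. by rewrite !(dotrC _ g) dotrZr. Qed.
Lemma dotrBl g x y : dotr (x - y) g = dotr x g - dotr y g.
Proof. by rewrite !(dotrC _ g) dotrBr. Qed.
Lemma dotr0 g : dotr g 0 = 0.
Proof. by rewrite -(scale0r 0) dotrZr mul0r. Qed.
Lemma dot0r g : dotr 0 g = 0. Proof. by rewrite dotrC dotr0. Qed.

Lemma powsum_ge0 p x : 0 <= powsum p x.
Proof. by rewrite sumr_ge0// => i _; rewrite powR_ge0. Qed.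

Lemma lpnorm_ge0 p x : 0 <= lpnorm p x. Proof. exact: powR_ge0. Qed.

Lemma lpnorm_powR p x : 0 < p -> lpnorm p x `^ p = powsum p x.
Proof. by move=> p0; rewrite /lpnorm powRVK ?powsum_ge0 ?gt_eqF. Qed.

Lemma lpnorm_le p x (D : R) : 0 < p -> 0 <= D ->
  (lpnorm p x <= D) = (powsum p x <= D `^ p).
Proof. by move=> p0 D0; rewrite -lpnorm_powR// ler_powR2// lpnorm_ge0. Qed.

Lemma ler_lpnorm p x y : 0 < p -> powsum p x <= powsum p y ->
  lpnorm p x <= lpnorm p y.
Proof. by move=> p0 xy; rewrite lpnorm_le// ?lpnorm_powR// lpnorm_ge0. Qed.

Lemma powsumZ p a x : powsum p (a *: x) = `|a| `^ p * powsum p x.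
Proof.
rewrite mulr_sumr; apply: eq_bigr => i _.
by rewrite mxE normrM powRM.
Qed.

Lemma powsum0 p : 0 < p -> powsum p 0 = 0.
Proof. by move=> p0; rewrite /powsum big1// => i _; rewrite mxE normr0 powR0 ?gt_eqF. Qed.

Lemma powsumN p x : powsum p (- x) = powsum p x.
Proof. by apply: eq_bigr => i _; rewrite mxE normrN. Qed.

Lemma powsumBC p x y : powsum p (x - y) = powsum p (y - x).
Proof. by rewrite -powsumN opprB. Qed.

Lemma lpnormZ p a x : 0 < p -> lpnorm p (a *: x) = `|a| * lpnorm p x.
Proof.
move=> p0; rewrite /lpnorm -!/(powsum p _) powsumZ powRM ?powR_ge0 ?powsum_ge0//.
by rewrite powRK ?gt_eqF.
Qed.

Lemma lpnormN p x : lpnorm p (- x) = lpnorm p x.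
Proof. by rewrite /lpnorm -!/(powsum p _) powsumN. Qed.

Lemma lpnormB p x y : lpnorm p (x - y) = lpnorm p (y - x).
Proof. by rewrite -lpnormN opprB. Qed.

Lemma lpnorm0 p : 0 < p -> lpnorm p (0 : 'rV[R]_d) = 0.
Proof. by move=> p0; rewrite -(scale0r 0) lpnormZ// normr0 mul0r. Qed.

Lemma powsum_convex p (th : R) x y : 1 <= p -> 0 <= th <= 1 ->
  powsum p (th *: x + (1 - th) *: y) <= th * powsum p x + (1 - th) * powsum p y.
Proof.
move=> p1 t01; rewrite !mulr_sumr -big_split ler_sum// => i _.
rewrite !mxE; exact: norm_powR_convex.
Qed.

(** Uniform convexity of degree p, in midpoint form and with a constant that
    does not depend on the dimension. The regularizers and the prox term of
    the method all owe their growth to it. *)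
Lemma clarkson p x y : 2 <= p ->
  powsum p (2^-1 *: (x + y)) + powsum p (2^-1 *: (x - y))
    <= (powsum p x + powsum p y) / 2.
Proof.
move=> p2; rewrite -!big_split mulr_suml ler_sum// => i _.
by rewrite !mxE !(mulrC 2^-1); exact: clarkson_scalar.
Qed.

Lemma lpnorm_eq0 p x : 0 < p -> lpnorm p x = 0 -> x = 0.
Proof.
move=> p0 /powR_eq0_eq0 /eqP.
rewrite psumr_eq0; last by move=> i _; rewrite powR_ge0.
move=> /allP h; apply/rowP => i; rewrite mxE.
have := h i (mem_index_enum _); rewrite powR_eq0 normr_eq0.
by move=> /andP[/eqP].
Qed.

Lemma lpnorm_le_sup (r : R) u (B : R) : 0 < r -> (forall i, `|u 0 i| <= B) ->
  lpnorm r u <= d%:R `^ r^-1 * B.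
Proof.
move=> r0 uB; have [d0|[i _]] : d = 0%N \/ exists i : 'I_d, True.
    by case: (d) => [|n]; [left | right; exists ord0].
  rewrite /lpnorm big1 ?powR0 ?invr_eq0 ?gt_eqF// => [|[i ilt]]; last by exfalso; rewrite d0 in ilt.
  by rewrite d0 powR0 ?mul0r// invr_eq0 gt_eqF.
have B0 : 0 <= B by exact: le_trans (normr_ge0 _) (uB i).
rewrite lpnorm_le// ?mulr_ge0 ?powR_ge0// powRM ?powR_ge0// powRVK ?gt_eqF//.
apply: (@le_trans _ _ (\sum_(i < d) B `^ r)).
  by apply: ler_sum => j _; apply: ge0_ler_powR; rewrite ?nnegrE// ltW.
by rewrite sumr_const card_ord mulr_natl.
Qed.

(** Convexity of the power sum at the normalized vectors, weighted by their
    share of the sum of the norms. *)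
Lemma ler_lpnormD p x y : 1 <= p -> lpnorm p (x + y) <= lpnorm p x + lpnorm p y.
Proof.
move=> p1; have p0 : 0 < p by lra.
have [/(lpnorm_eq0 p0) ->|xN0] := eqVneq (lpnorm p x) 0.
  by rewrite add0r lerDr lpnorm_ge0.
have [/(lpnorm_eq0 p0) ->|yN0] := eqVneq (lpnorm p y) 0.
  by rewrite addr0 lerDl lpnorm_ge0.
have ha : 0 < lpnorm p x by rewrite lt_neqAle eq_sym xN0 lpnorm_ge0.
have hb : 0 < lpnorm p y by rewrite lt_neqAle eq_sym yN0 lpnorm_ge0.
have := lpnorm_powR x p0; have := lpnorm_powR y p0.
move: (lpnorm p x) (lpnorm p y) ha hb {xN0 yN0} => a b ha hb yE xE.
set s := a + b; have s0 : 0 < s by rewrite addr_gt0.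
have th01 : 0 <= a / s <= 1.
  by apply/andP; split; [rewrite divr_ge0// ltW | rewrite ler_pdivrMr// mul1r /s; lra].
have h1 : 1 - a / s = b / s by rewrite /s; field; lra.
have := powsum_convex ((s / a) *: x) ((s / b) *: y) p1 th01.
rewrite h1 !scalerA.
have -> : a / s * (s / a) = 1 by field; apply/andP; split; lra.
have -> : b / s * (s / b) = 1 by field; apply/andP; split; lra.
have sa : 0 <= s / a by rewrite divr_ge0 ?ltW.
have sb : 0 <= s / b by rewrite divr_ge0 ?ltW.
rewrite !scale1r !powsumZ !ger0_norm// -xE -yE -!powRM ?(ltW ha) ?(ltW hb)//.
rewrite !divfK ?gt_eqF// -mulrDl -h1.
have -> : a / s + (1 - a / s) = 1 by lra.
by rewrite mul1r (lpnorm_le _ p0 (ltW s0)).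
Qed.

Lemma lpnorm_tri p x y z : 1 <= p -> lpnorm p (x - z) <= lpnorm p (x - y) + lpnorm p (y - z).
Proof.
move=> p1; have -> : x - z = (x - y) + (y - z) by rewrite addrA subrK.
exact: ler_lpnormD.
Qed.

Lemma coord_le_lpnorm p x i : 0 < p -> `|x 0 i| <= lpnorm p x.
Proof.
move=> p0; rewrite -(@ler_powR2 _ _ _ p)// ?lpnorm_ge0// lpnorm_powR//.
rewrite /powsum (bigD1 i)//= lerDl sumr_ge0// => j _; exact: powR_ge0.
Qed.

End norms.

Section duality.
Variables (R : realType) (d : nat).
Implicit Types (x y u v g : 'rV[R]_d) (p q : R).

Lemma conj_exp_gt1 p : 1 < p -> 1 < conjugate_exponent p.
Proof. by move=> p1; rewrite /conjugate_exponent ltr_pdivlMr; lra. Qed.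

Lemma conj_exp_sum p : 1 < p -> (conjugate_exponent p)^-1 + p^-1 = 1.
Proof. by move=> p1; rewrite /conjugate_exponent; field; apply/andP; split; lra. Qed.

Lemma conj_exp_sub1 p : 1 < p -> conjugate_exponent p - 1 = (p - 1)^-1.
Proof. by move=> p1; rewrite /conjugate_exponent; field; lra. Qed.

Lemma sum_normalized (r : R) (y : 'rV[R]_d) : 0 < r -> 0 < lpnorm r y ->
  \sum_(i < d) (`|y 0 i| / lpnorm r y) `^ r = 1.
Proof.
move=> r0 y0; under eq_bigr do rewrite powRM ?invr_ge0 ?lpnorm_ge0//.
rewrite -mulr_suml -/(powsum r y) -lpnorm_powR// -powRM ?lpnorm_ge0 ?invr_ge0 ?lpnorm_ge0//.
by rewrite divff ?powR1// gt_eqF.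
Qed.

(** Young's inequality, summed over the normalized vectors. *)
Lemma hoelder_sum p q g x : 0 < p -> 0 < q -> q^-1 + p^-1 = 1 ->
  \sum_(i < d) `|g 0 i| * `|x 0 i| <= lpnorm q g * lpnorm p x.
Proof.
move=> p0 q0 pq.
have [/(lpnorm_eq0 p0) ->|xN0] := eqVneq (lpnorm p x) 0.
  rewrite lpnorm0// mulr0 big1// => i _; by rewrite mxE normr0 mulr0.
have [/(lpnorm_eq0 q0) ->|gN0] := eqVneq (lpnorm q g) 0.
  rewrite lpnorm0// mul0r big1// => i _; by rewrite mxE normr0 mul0r.
have X0 : 0 < lpnorm p x by rewrite lt_neqAle eq_sym xN0 lpnorm_ge0.
have G0 : 0 < lpnorm q g by rewrite lt_neqAle eq_sym gN0 lpnorm_ge0.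
have hx := sum_normalized p0 X0; have hg := sum_normalized q0 G0.
move: (lpnorm p x) (lpnorm q g) X0 G0 hx hg {xN0 gN0} => X G X0 G0 hx hg.
have -> : \sum_(i < d) `|g 0 i| * `|x 0 i| =
    G * X * \sum_(i < d) (`|g 0 i| / G) * (`|x 0 i| / X).
  rewrite mulr_sumr; apply: eq_bigr => i _; field; apply/andP; split; lra.
have GX0 : 0 <= G * X by apply: mulr_ge0; exact: ltW.
rewrite -[leRHS]mulr1; apply: ler_wpM2l => //.
apply: (@le_trans _ _ (\sum_(i < d) ((`|g 0 i| / G) `^ q / q + (`|x 0 i| / X) `^ p / p))).
  by apply: ler_sum => i _; apply: conjugate_powR => //; apply: divr_ge0 => //; exact: ltW.
by rewrite big_split /= -!mulr_suml hx hg !mul1r pq.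
Qed.

Lemma hoelder_dotr p g x : 1 < p ->
  \sum_(i < d) `|g 0 i| * `|x 0 i| <= lpnorm (conjugate_exponent p) g * lpnorm p x.
Proof.
move=> p1; apply: hoelder_sum; [lra | | exact: conj_exp_sum].
have := conj_exp_gt1 p1; lra.
Qed.

Lemma dotr_le p g x : 1 < p ->
  dotr g x <= lpnorm (conjugate_exponent p) g * lpnorm p x.
Proof.
move=> p1; apply: le_trans (hoelder_dotr g x p1).
by apply: ler_sum => i _; rewrite -normrM ler_norm.
Qed.

(** Tested on the vector with entries sgn(g_i) |g_i|^(q-1), for which Hölder's
    inequality is an equality. *)
Lemma lpnorm_dual p g (c : R) : 1 < p -> 0 <= c ->
  (forall u, dotr g u <= c * lpnorm p u) -> lpnorm (conjugate_exponent p) g <= c.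
Proof.
move=> p1 c0 h; have q1 := conj_exp_gt1 p1; have pq := conj_exp_sum p1.
have qB := conj_exp_sub1 p1.
have qE : (conjugate_exponent p - 1) * p = conjugate_exponent p.
  by rewrite /conjugate_exponent; field; lra.
move: (conjugate_exponent p) q1 pq qB qE => q q1 pq qB qE.
have p0 : 0 < p by lra.
have q0 : 0 < q by lra.
pose u : 'rV[R]_d := \row_i (Num.sg (g 0 i) * `|g 0 i| `^ (q - 1)).
have gu : dotr g u = powsum q g.
  apply: eq_bigr => i _; rewrite mxE mulrA (mulrC (g 0 i)) -normrEsg.
  by rewrite mulr_powRB1.
have uN : powsum p u = powsum q g.
  apply: eq_bigr => i _; rewrite mxE normrM (ger0_norm (powR_ge0 _ _)).
  have [->|g0] := eqVneq (g 0 i) 0.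
    by rewrite sgr0 normr0 mul0r !powR0// gt_eqF.
  by rewrite normr_sg g0 mul1r -powRrM qE.
have := h u; rewrite gu /lpnorm -/(powsum p u) uN -/(powsum q g).
have := powsum_ge0 q g; rewrite le_eqVlt => /orP[/eqP<- _|N0].
  by rewrite powR0// invr_eq0 gt_eqF.
have -> : q^-1 = 1 - p^-1 by lra.
have -> : powsum q g `^ (1 - p^-1) = powsum q g / powsum q g `^ p^-1.
  rewrite powRB; last by rewrite (gt_eqF N0) implybT.
  by rewrite powRr1// ltW.
by rewrite ler_pdivrMr ?powR_gt0.
Qed.

End duality.

(** * Convexity and differentiability *)

Section convex_functions.
Variables (R : realType) (d : nat).
Implicit Types (x y z u v c : 'rV[R]_d) (f g G : 'rV[R]_d -> R) (p : R).

Definition convexf f := forall (t : R) x y, 0 <= t <= 1 ->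
  f (t *: x + (1 - t) *: y) <= t * f x + (1 - t) * f y.

Lemma convex_functionP f : convex_function [set: 'rV[R]_d] f <-> convexf f.
Proof.
split => [h t x y /andP[t0 t1]|h t x y _ _].
  by have := h (Itv01 t0 t1) x y; rewrite convRE; apply; rewrite in_setE.
by rewrite convRE; apply: h; rewrite ge0 le1.
Qed.

Lemma convex_mid f x y : convexf f -> f (2^-1 *: (x + y)) <= (f x + f y) / 2.
Proof.
move=> cf; have := cf 2^-1 x y; rewrite scalerDr.
have -> : 1 - 2^-1 = 2^-1 :> R by lra.
by move=> /(_ ltac:(lra)); rewrite mulrC; lra.
Qed.

Lemma derive_dotr f x v : differentiable f x -> 'D_v f x = dotr (gradient f x) v.
Proof.
move=> df; rewrite deriveE// [in LHS](row_sum_delta v) linear_sum.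
apply: eq_bigr => i _; rewrite mxE linearZ /= deriveE//.
by rewrite mulrC.
Qed.

(** The difference quotients of f along y - x with step in ]0,1[ are at most f
    y - f x, hence so is their limit. *)
Lemma convex_first_order f x y : differentiable f x -> convexf f ->
  f x + dotr (gradient f x) (y - x) <= f y.
Proof.
move=> df cf; rewrite -derive_dotr// -lerBrDl leNgt; apply/negP => lt.
have hd := @diff_derivable _ _ _ f x (y - x) df.
have hr : \forall h \near (0 : R)^'+,
    f y - f x < h^-1 *: ((f \o shift x) (h *: (y - x)) - f x).
  exact: cvgr_gt (cvg_dnbhs_at_right hd) _ lt.
have hgt := nbhs_right_gt (0 : R).
have hlt := @nbhs_right_lt R 0 1 ltr01.
have [h [/= h1 [h0 hl]]] := filter_ex (filterI hr (filterI hgt hlt)).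
have := cf h y x; rewrite (ltW h0) (ltW hl) => /(_ isT).
have -> : h *: y + (1 - h) *: x = h *: (y - x) + x.
  by apply/rowP => i; rewrite !mxE; ring.
move: h1; rewrite /GRing.scale /= -(ltr_pM2l h0) mulrA divff ?gt_eqF// mul1r; lra.
Qed.

Lemma continuous_sum (T : topologicalType) (I : Type) (r : seq I)
    (F : I -> T -> R) :
  (forall i, continuous (F i)) -> continuous (fun t => \sum_(i <- r) F i t).
Proof.
move=> cF; elim: r => [|i r IH] t.
  under eq_fun do rewrite big_nil; exact: cst_continuous.
under eq_fun do rewrite big_cons.
by apply: cvgD; [exact: cF | exact: IH].
Qed.

Lemma continuous_dotr (w : 'rV[R]_d) : continuous (dotr w : 'rV[R]_d -> R).
Proof.
apply: continuous_sum => i t.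
apply: (@continuousM _ _ (fun=> w 0 i) (fun x : 'rV[R]_d => x 0 i)).
  exact: cst_continuous.
exact: coord_continuous.
Qed.

Lemma continuous_powsum p c : 0 < p ->
  continuous (fun x : 'rV[R]_d => powsum p (x - c)).
Proof.
move=> p0; apply: continuous_sum => i t.
apply: (@continuous_comp _ _ _ (fun x : 'rV[R]_d => (x - c) 0 i) (fun y : R => `|y| `^ p));
  last exact: continuous_norm_powR.
have -> : (fun x : 'rV[R]_d => (x - c) 0 i) = (fun x => x 0 i) - (fun=> c 0 i).
  by apply/funext => x; rewrite !mxE.
by apply: continuousB; [exact: coord_continuous | exact: cst_continuous].
Qed.

Lemma coord_le_mxnorm u i : `|u 0 i| <= `|u|.
Proof.
rewrite -[leRHS]/(mx_norm u) mx_normrE.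
by apply/bigmax_geP; right; exists (0, i).
Qed.

(** The way to differentiate a function defined by a maximization: its
    variations are trapped between linear ones up to a quadratic error. *)
Lemma quadratic_differentiable f x (g : 'rV[R]_d) (K : R) :
  (forall h, `|f (h + x) - f x - dotr g h| <= K * `|h| ^+ 2) ->
  differentiable f x /\ gradient f x = g.
Proof.
move=> hK.
have dlin : linear_for *%R (dotr g) by move=> a u v; rewrite dotrDr dotrZr.
pose dL := HB.pack_for {linear 'rV[R]_d -> R} (dotr g)
  (GRing.isLinear.Build _ _ _ _ (dotr g) dlin).
have dc : continuous dL.
  exact: continuous_dotr.
pose g' : 'rV[R]_d -> R^o := cst (f x) + (dL : 'rV[R]_d -> R).
have e := @eqaddoP R 'rV[R]_d R^o 'rV[R]_d (nbhs (0 : 'rV[R]_d)) (f \o shift x) g' id.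
have {}e : (f \o shift x : 'rV[R]_d -> R^o) = g' +o_ (0 : 'rV[R]_d) id.
  apply/e => eps e0.
  have k0 : 0 < `|K| + 1 by rewrite ltr_wpDl.
  have H : \forall h \near (0 : 'rV[R]_d), `|h| <= eps / (`|K| + 1).
    by apply: nbhs0_le; exact: divr_gt0.
  near=> h.
  rewrite [leLHS](_ : _ = `|f (h + x) - f x - dotr g h|); last first.
    by rewrite !fctE /= opprD addrA.
  apply: le_trans (hK h) _; rewrite expr2 mulrA ler_wpM2r//.
  have : `|h| <= eps / (`|K| + 1).
    by near: h; exact: H.
  rewrite ler_pdivlMr// => hh; apply: le_trans hh.
  rewrite mulrC ler_wpM2l//; apply: le_trans (ler_norm _) _; lra.
have hd := diff_unique dc e.
have df : differentiable f x.
  by apply/diff_locallyP; rewrite hd.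
split => //; apply/rowP => i; rewrite mxE deriveE// hd /= /dotr (bigD1 i)//= big1 ?addr0 => [|j ji].
  by rewrite mxE !eqxx mulr1.
by rewrite mxE eqxx (negbTE ji) mulr0.
Unshelve. all: by end_near.
Qed.

End convex_functions.

(** * Minimizers of uniformly convex regularizations *)

Section minimizers.
Variables (R : realType) (d : nat).
Implicit Types (x y z u v c : 'rV[R]_d) (f g G Phi : 'rV[R]_d -> R) (p : R).

Lemma bounded_coordinates (A : set 'rV[R]_d) (M : R) :
  (forall x, A x -> forall i, `|x 0 i| <= M) -> bounded_set A.
Proof.
move=> AM; exists `|M|; split; first exact: num_real.
move=> N MN x Ax; rewrite /= -[`|x|]/(mx_norm x) mx_normrE.
apply/bigmax_leP; split => [|[i j] _ /=]; first exact: le_trans (normr_ge0 M) (ltW MN).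
rewrite ord1; apply: le_trans (AM x Ax j) _; apply: le_trans (ler_norm _) (ltW MN).
Qed.

(** Compactness of a sublevel set. *)
Lemma sublevel_argmin Phi c (M : R) : continuous Phi ->
  (forall x, Phi x <= Phi c -> forall i, `|x 0 i| <= M) -> argmin Phi !=set0.
Proof.
move=> cPhi hM; pose A := [set x | Phi x <= Phi c].
have cA : compact A.
  apply: bounded_closed_compact; first exact: bounded_coordinates hM.
  have -> : A = Phi @^-1` [set y | y <= Phi c] by [].
  by apply: preimage_closed; [move=> x _; exact: cPhi | exact: closed_le].
have A0 : A !=set0 by exists c; exact: lexx.
have [z] := EVT_min_rV A0 cA (continuous_subspaceT cPhi).
rewrite in_setE => zA zmin; exists z => y.
have [yA|/ltW yA] := leP (Phi y) (Phi c); first by apply: zmin; rewrite in_setE.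
exact: le_trans zA yA.
Qed.

Lemma powR_ge_linear p (a b : R) : 2 <= p -> 0 <= a ->
  a - (b + 1) ^+ 2 / 4 - 1 <= a `^ p - b * a.
Proof.
move=> p2 a0.
have h : a ^+ 2 - 1 <= a `^ p.
  have [a1|a1] := leP a 1.
    by apply: (@le_trans _ _ 0); [nra | exact: powR_ge0].
  apply: (@le_trans _ _ (a ^+ 2)); first lra.
  by rewrite -powR_mulrn// ler_powR// ltW.
have := sqr_ge0 (a - (b + 1) / 2); rewrite !expr2 in h *; lra.
Qed.

(** Coordinate by coordinate the power |w_j|^p, p >= 2, outgrows the linear
    term by at least |w_j| up to a constant, so that the sublevel sets are
    bounded. *)
Lemma coercive_argmin p Phi c v (mu b : R) : 2 <= p -> 0 < mu -> continuous Phi ->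
  (forall z, b + dotr v z + mu * powsum p (z - c) <= Phi z) -> argmin Phi !=set0.
Proof.
move=> p2 mu0 cPhi hPhi.
(* The constant of [powR_ge_linear] for the slope |v_j| / mu. *)
pose C j := (`|v 0 j| / mu + 1) ^+ 2 / 4 + 1.
pose S := \sum_(j < d) C j.
have C0 j : 0 <= C j by rewrite addr_ge0// divr_ge0// sqr_ge0.
have S0 : 0 <= S by apply: sumr_ge0.
pose M0 := (Phi c - b - dotr v c) / mu + S.
apply: (@sublevel_argmin Phi c (M0 + \sum_(j < d) `|c 0 j|)) => // x xc i.
set w := x - c.
have h1 : b + dotr v c + dotr v w + mu * powsum p w <= Phi c.
  have -> : b + dotr v c + dotr v w = b + dotr v x.
    by rewrite -addrA -dotrDr /w addrC subrKC addrC.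
  exact: le_trans (hPhi x) xc.
have h2 : - (mu * \sum_j (`|v 0 j| / mu) * `|w 0 j|) <= dotr v w.
  rewrite lerNl -dotrNr mulr_sumr; apply: ler_sum => j _.
  rewrite mxE mulrA mulrCA divff ?gt_eqF// mulr1 -normrM.
  by rewrite mulrN -normrN ler_norm.
have h3 : `|w 0 i| - S <= \sum_j (`|w 0 j| `^ p - (`|v 0 j| / mu) * `|w 0 j|).
  apply: (@le_trans _ _ (\sum_j (`|w 0 j| - C j))).
    rewrite sumrB lerB// (bigD1 i)//= lerDl sumr_ge0//.
  apply: ler_sum => j _; have := @powR_ge_linear p `|w 0 j| (`|v 0 j| / mu) p2 (normr_ge0 _).
  by rewrite /C; lra.
have h4 : `|w 0 i| <= M0.
  rewrite -lerBlDr; apply: le_trans h3 _.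
  rewrite ler_pdivlMr// sumrB mulrBl -/(powsum p w); lra.
have -> : x 0 i = w 0 i + c 0 i by rewrite !mxE subrK.
apply: le_trans (ler_normD _ _) (lerD h4 _).
by rewrite (bigD1 i)//= lerDl sumr_ge0.
Qed.

(** The factor 2^(-p) comes from the power sum of a half difference in
    [clarkson]; the factor 2 from clearing the mean of two values. *)
Definition ucvx_const p : R := 2 * 2^-1 `^ p.

Lemma ucvx_const_gt0 p : 0 < ucvx_const p.
Proof. by rewrite mulr_gt0// powR_gt0 invr_gt0. Qed.

Lemma ucvx_const_le1 p : 2 <= p -> ucvx_const p <= 1.
Proof.
move=> p2; rewrite /ucvx_const.
have : (2^-1 : R) `^ p <= 2^-1 `^ 1.
  apply: ger_powR; lra.
rewrite powRr1; lra.
Qed.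

(** The midpoint of z and u is no better than z, and [clarkson] measures how
    much better than the mean of the two values it has to be. *)
Lemma argmin_growth p Psi Phi c (mu : R) z u : 2 <= p -> 0 <= mu ->
  convexf Psi -> (forall x, Phi x = Psi x + mu * powsum p (x - c)) ->
  argmin Phi z -> Phi z + mu * ucvx_const p * powsum p (u - z) <= Phi u.
Proof.
move=> p2 mu0 cP PhiE zm.
have h := zm (2^-1 *: (z + u)).
have h1 := convex_mid z u cP.
have h2 := clarkson (z - c) (u - c) p2.
have e1 : 2^-1 *: ((z - c) + (u - c)) = 2^-1 *: (z + u) - c.
  by apply/rowP => i; rewrite !mxE; field.
have e2 : z - c - (u - c) = - (u - z) by apply/rowP => i; rewrite !mxE; ring.
move: h2; rewrite e1 e2 powsumZ powsumN => h2.
have e3 : `|(2^-1 : R)| = 2^-1 by rewrite ger0_norm.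
rewrite e3 in h2.
move: h; rewrite !PhiE => h.
have h3 := ler_wpM2l mu0 h2.
rewrite /ucvx_const; lra.
Qed.

End minimizers.

Section smooth_convex.
Variables (R : realType) (d : nat) (p L : R) (f : 'rV[R]_d -> R).
Hypotheses (p2 : 2 < p) (L0 : 0 < L) (adm : admissible p L f).
Implicit Types (x y z u v c : 'rV[R]_d).

Let p1 : 1 < p. Proof. by apply: lt_trans p2; rewrite ltr1n. Qed.
Let p0 : 0 < p. Proof. exact: lt_trans p1. Qed.

Lemma admissible_convexf : convexf f.
Proof. by case: adm => _ /convex_functionP. Qed.

Lemma admissible_continuous : continuous f.
Proof. by case: adm => df _ _ _ x; exact: differentiable_continuous. Qed.

Lemma admissible_first_order x y : f x + dotr (gradient f x) (y - x) <= f y.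
Proof. by case: adm => df _ _ _; apply: convex_first_order => //; exact: admissible_convexf. Qed.

Lemma gradient_dotr_le x y u :
  dotr (gradient f y - gradient f x) u <= L * lpnorm p (y - x) * lpnorm p u.
Proof.
apply: le_trans (dotr_le _ _ p1) _.
by apply: ler_wpM2r; [exact: lpnorm_ge0 | case: adm].
Qed.

(** Convexity at y bounds f y - f x by the pairing of y - x with the gradient
    at y, and the Lipschitz bound replaces it with the gradient at x. This
    costs a factor 2 with respect to the usual constant L/2. *)
Lemma descent x y : f y <= f x + dotr (gradient f x) (y - x) + L * lpnorm p (y - x) ^+ 2.
Proof.
have h := admissible_first_order y x.
have := gradient_dotr_le x y (y - x); rewrite dotrBl expr2 mulrA.
move: h; rewrite -(opprB y x) dotrNr; lra.
Qed.

Lemma gradient_lip x y : lpnorm (conjugate_exponent p) (gradient f x)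
  <= lpnorm (conjugate_exponent p) (gradient f y) + L * lpnorm p (x - y).
Proof.
have q1 := conj_exp_gt1 p1.
have -> : gradient f x = gradient f y + (gradient f x - gradient f y) by rewrite subrKC.
apply: le_trans (ler_lpnormD _ _ (ltW q1)) _; rewrite lerD2l.
by case: adm.
Qed.

Definition regularizer (h : seq (R * 'rV[R]_d)) x : R :=
  \sum_(w <- h) w.1 * powsum p (x - w.2).

(** At z the gradient of f balances the gradient of the regularizer. The
    comparison of z with z + u, where u has norm tau, gives this in finite
    form; tau is kept rather than sent to 0, since in the application the
    distances are themselves only known up to such a slack. *)
Lemma gradient_at_regularized_min (h : seq (R * 'rV[R]_d)) z (tau : R) :
  (forall w, w \in h -> 0 <= w.1) -> 0 < tau ->
  argmin (fun x => f x + regularizer h x) z ->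
  lpnorm (conjugate_exponent p) (gradient f z) <=
    p * \sum_(w <- h) w.1 * (lpnorm p (z - w.2) + tau) `^ (p - 1) + L * tau.
Proof.
move=> h0 t0 zm; set S := \sum_(w <- h) _.
have S0 : 0 <= S.
  rewrite /S big_seq; apply: sumr_ge0 => w wh; apply: mulr_ge0; [exact: h0 | exact: powR_ge0].
have C0 : 0 <= p * S + L * tau.
  by apply: addr_ge0; apply: mulr_ge0 => //; exact: ltW.
suff hu u : lpnorm p u = tau -> - dotr (gradient f z) u <= (p * S + L * tau) * tau.
  apply: lpnorm_dual => // u.
  have [/(lpnorm_eq0 p0) ->|uN0] := eqVneq (lpnorm p u) 0.
    by rewrite dotr0 mulr_ge0// lpnorm_ge0.
  have u0 : 0 < lpnorm p u by rewrite lt_neqAle eq_sym uN0 lpnorm_ge0.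
  have k0 : 0 < tau / lpnorm p u by exact: divr_gt0.
  have := hu (- (tau / lpnorm p u) *: u).
  rewrite lpnormZ// normrN (ger0_norm (ltW k0)) divfK ?gt_eqF// => /(_ erefl).
  rewrite dotrZr mulNr opprK.
  have -> : (p * S + L * tau) * tau = (tau / lpnorm p u) * ((p * S + L * tau) * lpnorm p u).
    by field; exact: lt0r_neq0.
  by rewrite ler_pM2l.
move=> ut.
have h1 := admissible_first_order (z + u) z.
have h2 := zm (z + u).
have h3 : regularizer h (z + u) - regularizer h z <= tau * (p * S).
  rewrite /regularizer -sumrB /S !mulr_sumr big_seq [leRHS]big_seq.
  apply: ler_sum => w wh.
  have -> : tau * (p * (w.1 * (lpnorm p (z - w.2) + tau) `^ (p - 1))) =
    w.1 * (tau * (p * (lpnorm p (z - w.2) + tau) `^ (p - 1))) by ring.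
  rewrite -mulrBr; apply: ler_wpM2l; first exact: h0.
  rewrite -!lpnorm_powR//.
  have a0 := lpnorm_ge0 p (z - w.2).
  have a1 : 0 <= lpnorm p (z - w.2) + tau by apply: addr_ge0 => //; exact: ltW.
  have tg := powR_tangent (ltW p1) a1 a0.
  have : lpnorm p (z + u - w.2) `^ p <= (lpnorm p (z - w.2) + tau) `^ p.
    rewrite ler_powR2 ?lpnorm_ge0//.
    by rewrite addrAC -ut; apply: ler_lpnormD; exact: ltW.
  move: tg; rewrite opprD addrA subrr add0r => tg le.
  rewrite lerBlDr; apply: le_trans le _; rewrite -lerBlDl.
  by move: tg; rewrite mulrN [tau * _]mulrC.
have h4 := gradient_dotr_le z (z + u) u.
move: h1 h4; rewrite opprD addrA subrr add0r dotrNr dotrBl (addrC z u) addrK ut.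
rewrite (addrC u z); lra.
Qed.

End smooth_convex.

(** * Query strategies and the accelerated method *)

Section strategies.
Variables (R : realType) (d : nat).
Implicit Types (x y z u v c : 'rV[R]_d) (f : 'rV[R]_d -> R).

(** A deterministic method as a decision tree, whose last query is its output.
    Trees, unlike functions of the whole history, compose by continuations:
    each stage hands its result over to the next. *)
Inductive strategy :=
| Output of 'rV[R]_d
| Ask of 'rV[R]_d & (R * 'rV[R]_d -> strategy).

Definition first_query s := match s with Output x => x | Ask x _ => x end.

Fixpoint next_query s (h : seq (R * 'rV[R]_d)) : option 'rV[R]_d :=
  match s, h with
  | Output x, [::] => Some x
  | Output _, _ :: _ => None
  | Ask x _, [::] => Some x
  | Ask _ k, a :: h' => next_query (k a) h'
  end.

Fixpoint trace f s : seq 'rV[R]_d :=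
  match s with
  | Output x => [:: x]
  | Ask x k => x :: trace f (k (oracle f x))
  end.

Definition algorithm_step s (h : seq (R * 'rV[R]_d)) : 'rV[R]_d + 'I_(size h) :=
  match h return 'rV[R]_d + 'I_(size h) with
  | [::] => inl (first_query s)
  | a :: h' => if next_query s (a :: h') is Some x then inl x else inr ord_max
  end.

Definition strategy_algorithm s : algorithm (first_query s) :=
  @Algorithm R d _ (algorithm_step s) erefl.

Lemma next_query_trace f s n : next_query s (map (oracle f) (take n (trace f s))) =
  if (n < size (trace f s))%N then Some (nth 0 (trace f s) n) else None.
Proof.
by elim: s n => [x|x k IH] [|n] //=; rewrite IH ltnS.
Qed.

Lemma trace_gt0 f s : (0 < size (trace f s))%N. Proof. by case: s. Qed.

Lemma algorithm_step_next s h x : next_query s h = Some x ->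
  algorithm_step s h = inl x.
Proof.
case: h => [|a h]; last by rewrite /algorithm_step => ->.
by case: s => [y|y k] /= [<-].
Qed.

Lemma queries_strategy f s n : (n <= size (trace f s))%N ->
  queries (strategy_algorithm s) f n = take n (trace f s).
Proof.
elim: n => [|n IH] nt; first by rewrite take0.
have hn := next_query_trace f s n; rewrite nt in hn.
rewrite /= IH ?(ltnW nt)// (algorithm_step_next hn) -take_nth//.
Qed.

Lemma returns_strategy f s :
  returns (strategy_algorithm s) f (size (trace f s)) (last 0 (trace f s)).
Proof.
rewrite /returns queries_strategy// take_size; split => //.
have := next_query_trace f s (size (trace f s)); rewrite take_size ltnn.
have := trace_gt0 f s.
case: (trace f s) => [//|x t] _ /= E.
by exists ord_max; rewrite E; split => //=; rewrite size_map nth_last.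
Qed.

End strategies.

Section accelerated_method.
Variables (R : realType) (d : nat) (p L : R) (f G : 'rV[R]_d -> R) (c : 'rV[R]_d).
Hypotheses (p2 : 2 < p) (L0 : 0 < L) (adm : admissible p L f).
Hypotheses (G0 : forall x, 0 <= G x) (cG : continuous G) (vG : convexf G).
Implicit Types (x y z u v : 'rV[R]_d).

(** The sum al + 2 al + ... + k al of the weights of the first k queries. *)
Definition weight (al : R) (k : nat) : R := al * (k%:R * (k%:R + 1) / 2).

(** Up to a constant, the weighted lower bound of f + G collected so far, plus
    the prox term; v accumulates the weighted gradients. *)
Definition model (W : R) v u : R := dotr v u + W * G u + powsum p (u - c).

Definition model_argmin (W : R) v : 'rV[R]_d := xget c (argmin (model W v)).

(** Each step costs one query: minimizing the model involves only the known
    function G and the answers already received. The result y is the weighted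
    mean of the model minimizers z. *)
Fixpoint accelerate (al : R) (n k : nat) v z y (K : 'rV[R]_d -> strategy R d) :
    strategy R d :=
  if n is n'.+1 then
    let th := 2 / (k%:R + 2) in
    Ask ((1 - th) *: y + th *: z) (fun o =>
      let v' := v + (al * (k%:R + 1)) *: o.2 in
      let z' := model_argmin (weight al k.+1) v' in
      accelerate al n' k.+1 v' z' ((1 - th) *: y + th *: z') K)
  else K y.

Lemma model_argminP (W : R) v : 0 <= W -> argmin (model W v) (model_argmin W v).
Proof.
move=> W0; have [z zm] : argmin (model W v) !=set0; last first.
  by rewrite /model_argmin; case: xgetP => [w -> //|/(_ z)].
apply: (@coercive_argmin _ _ p _ c v 1 0); rewrite ?(ltW p2)//.
  move=> x; apply: (@continuousD _ _ _ (fun u => dotr v u + W * G u) (fun u => powsum p (u - c))).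
    apply: (@continuousD _ _ _ (dotr v) (fun u => W * G u)); first exact: continuous_dotr.
    by apply: (@continuousM _ _ (fun=> W) G); [exact: cst_continuous | exact: cG].
  by apply: continuous_powsum; apply: lt_trans p2.
by move=> z; rewrite add0r mul1r lerD2r lerDl mulr_ge0.
Qed.

(** An estimate sequence: b + <v, u> is a weighted lower bound of f, and the
    minimum of the model already dominates the weighted objective at y, up to
    an error E per step. *)
Definition accelerated_invariant (al E : R) (k : nat) v z y :=
  exists b, [/\ forall u, b + dotr v u <= weight al k * f u,
    weight al k * (f y + G y) <= b + model (weight al k) v z + k%:R * E
    & argmin (model (weight al k) v) z].

Lemma accelerated_invariant0 al E : accelerated_invariant al E 0 0 c c.
Proof.
have w0 : weight al 0 = 0 by rewrite /weight !mul0r mulr0.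
have p0 : 0 < p by apply: lt_trans p2.
exists 0; split => [u||u]; rewrite ?w0 /model ?dot0r ?mul0r ?add0r//.
  by rewrite addr0 powsum_ge0.
by rewrite subrr powsum0// powsum_ge0.
Qed.

Lemma weight_ge0 al k : 0 <= al -> 0 <= weight al k.
Proof. by move=> a0; rewrite /weight mulr_ge0// divr_ge0// mulr_ge0// addr_ge0. Qed.

(** The new y differs from the query x by th (z' - z), so the descent error is
    quadratic in |z' - z|, whereas the old model has grown by a p-th power of
    |z' - z| between its minimizer z and z'. Neither dominates the other for p
    > 2: the hypothesis on E says what remains. *)
Lemma accelerated_step al E k v z y :
  let th := 2 / (k%:R + 2) in
  let x := (1 - th) *: y + th *: z in
  let v' := v + (al * (k%:R + 1)) *: gradient f x in
  let z' := model_argmin (weight al k.+1) v' in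
  0 < al ->
  (forall s, 0 <= s -> 2 * al * L * s ^+ 2 <= ucvx_const p * s `^ p + E) ->
  accelerated_invariant al E k v z y ->
  accelerated_invariant al E k.+1 v' z' ((1 - th) *: y + th *: z').
Proof.
move=> th x v' z' al0 hE [b [I1 I2 I3]].
have p0 : 0 < p by apply: lt_trans p2.
set a := al * (k%:R + 1).
set W := weight al k; set W' := weight al k.+1.
have k20 : 0 < k%:R + 2 :> R by rewrite ltr_wpDl.
have W0 : 0 <= W by apply: weight_ge0; exact: ltW.
have W'0 : 0 <= W' by apply: weight_ge0; exact: ltW.
have e1 : W' * th = a.
  by rewrite /W' /weight /th /a -natr1; field; exact: lt0r_neq0.
have e2 : W' * (1 - th) = W.
  by rewrite mulrBr mulr1 e1 /W' /W /weight /a -natr1; field.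
have eW : W' = W + a by rewrite -e1 -e2; ring.
have a0 : 0 <= a by rewrite mulr_ge0// ?(ltW al0)// addr_ge0.
have th01 : 0 <= 1 - th <= 1.
  rewrite subr_ge0 gerBl /th divr_ge0 ?(ltW k20)// andbT ler_pdivrMr// mul1r lerDr//.
set y' := (1 - th) *: y + th *: z'.
set g := gradient f x.
have I3' : argmin (model W' v') z' by exact: model_argminP.
(* The constant term of the new linearization, with its weight a. *)
exists (b + a * (f x - dotr g x)); split => //.
  move=> u; have h1 := I1 u; have h2 := admissible_first_order adm x u.
  have h3 := ler_wpM2l a0 h2.
  rewrite -/W' eW /v' -/g -/a dotrDl dotrZl.
  move: h1 h3; rewrite -/W -/g dotrBr; lra.
rewrite -/W'.
have yx : y' - x = th *: (z' - z) by apply/rowP => i; rewrite !mxE; ring.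
set s := lpnorm p (z' - z).
have s0 : 0 <= s by exact: lpnorm_ge0.
have th0 : 0 <= th by lra.
have d1 : f y' <= f x + dotr g (y' - x) + L * (th * s) ^+ 2.
  have := descent p2 adm x y'; rewrite {2}yx lpnormZ// ger0_norm//.
have d2 : W' * G y' <= W * G y + a * G z'.
  have := vG y z' th01; have -> : 1 - (1 - th) = th by ring.
  move=> /(ler_wpM2l W'0).
  by rewrite -/y' mulrDr (mulrA W' (1 - th)) (mulrA W' th) e1 e2.
have d3 : dotr g (y' - x) = (1 - th) * dotr g (y - x) + th * dotr g (z' - x).
  by rewrite /y' !dotrBr dotrDr !dotrZr; ring.
have d4 := admissible_first_order adm x y.
have d5 : W' * (L * (th * s) ^+ 2) <= ucvx_const p * s `^ p + E.
  apply: le_trans (hE s s0).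
  have -> : W' * (L * (th * s) ^+ 2) = (a * th) * (L * s ^+ 2).
    by rewrite -e1 !expr2; ring.
  have -> : 2 * al * L * s ^+ 2 = 2 * al * (L * s ^+ 2) by ring.
  apply: ler_wpM2r; first by rewrite mulr_ge0 ?sqr_ge0// ltW.
  rewrite /a /th mulrA ler_pdivrMr//; nra.
have d6 := @argmin_growth R d p (fun u => dotr v u + W * G u) (model W v) c 1 z z' (ltW p2) ler01.
have {}d6 : model W v z + ucvx_const p * s `^ p <= model W v z'.
  rewrite /s lpnorm_powR//.
  have := d6 _ _ I3; rewrite !mul1r; apply; last by move=> u; rewrite mul1r.
  move=> t u w t01; have := vG u w t01 => /(ler_wpM2l W0).
  rewrite dotrDr !dotrZr; lra.
have d7 := ler_wpM2l W'0 d1.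
have d8 := ler_wpM2l W0 d4.
have m' : model W' v' z' = model W v z' + a * dotr g z' + a * G z'.
  by rewrite /model /v' dotrDl dotrZl -/a -/g eW; ring.
rewrite m' -natr1.
have d9 : W' * (f x + dotr g (y' - x)) = W * (f x + dotr g (y - x)) + a * (f x + dotr g (z' - x)).
  by rewrite d3 -e1 -e2; ring.
move: I2 d8; rewrite -/W -/g => I2 d8.
move: d7; rewrite mulrDr d9 => d7.
rewrite mulrDr.
have d10 : dotr g (z' - x) = dotr g z' - dotr g x by rewrite dotrBr.
rewrite d10 in d7.
lra.
Qed.

Lemma accelerate_trace al E n k v z y K :
  0 < al ->
  (forall s, 0 <= s -> 2 * al * L * s ^+ 2 <= ucvx_const p * s `^ p + E) ->
  accelerated_invariant al E k v z y ->
  exists pre v' z' y', [/\ trace f (accelerate al n k v z y K) = pre ++ trace f (K y'),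
    size pre = n & accelerated_invariant al E (k + n) v' z' y'].
Proof.
move=> al0 hE; elim: n k v z y => [|n IH] k v z y inv.
  by exists [::], v, z, y; rewrite addn0.
have [pre [v' [z' [y' [tr sz inv']]]]] := IH _ _ _ _ (accelerated_step al0 hE inv).
by eexists (_ :: pre), v', z', y'; split; [rewrite /= tr | rewrite /= sz | rewrite addnS -addSn].
Qed.

End accelerated_method.

(** * One accelerated stage *)

Section one_stage.
Variables (R : realType) (d : nat) (p L : R) (f G : 'rV[R]_d -> R) (c : 'rV[R]_d).
Hypotheses (p2 : 2 < p) (L0 : 0 < L) (adm : admissible p L f).
Hypotheses (G0 : forall x, 0 <= G x) (cG : continuous G) (vG : convexf G).
Implicit Types (x y z u v : 'rV[R]_d).

Lemma powR_sqr_split (s : R) : 0 <= s -> s `^ p = s `^ (p - 2) * s ^+ 2.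
Proof.
move=> s0; rewrite -powR_mulrn// -powRD ?subrK//.
by apply/implyP; rewrite gt_eqF// (lt_trans _ p2).
Qed.

(** The threshold s = sg decides which of the two terms on the right
    dominates. *)
Lemma quadratic_le_powR (sg s : R) : 0 <= sg -> 0 <= s ->
  sg `^ (p - 2) * s ^+ 2 <= s `^ p + sg `^ p.
Proof.
move=> sg0 s0; have p20 : 0 <= p - 2 by rewrite subr_ge0 ltW.
have [le|/ltW le] := leP s sg.
  rewrite (powR_sqr_split sg0); apply: (@le_trans _ _ (sg `^ (p - 2) * sg ^+ 2)).
    by rewrite ler_wpM2l ?powR_ge0// lerXn2r ?nnegrE.
  by rewrite lerDr powR_ge0.
rewrite (powR_sqr_split s0); apply: (@le_trans _ _ (s `^ (p - 2) * s ^+ 2)).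
  by rewrite ler_wpM2r ?sqr_ge0// ge0_ler_powR ?nnegrE.
by rewrite lerDl powR_ge0.
Qed.

(** At this scale the quadratic and the p-th power errors of a step balance,
    and T errors of size stage_radius^p add up to D^p. *)
Definition stage_radius (D : R) (T : nat) : R := D / T%:R `^ p^-1.

Definition stage_rate (D : R) (T : nat) : R :=
  ucvx_const p * stage_radius D T `^ (p - 2) / (2 * L).

(** The T errors E add up to the prox term at distance D, by the choice of
    stage_radius, and the total weight of the queries is of order
    stage_radius^(p-2) T^2 / L. *)
Lemma one_stage (D : R) (T : nat) u K : 0 < D -> (0 < T)%N -> lpnorm p (u - c) <= D ->
  exists pre y, [/\
    trace f (accelerate p G c (stage_rate D T) T 0 0 c c K) = pre ++ trace f (K y),
    size pre = T
  & f y + G y - (f u + G u) <= 8 * L * D ^+ 2 / (ucvx_const p * T%:R `^ (1 + 2 / p))].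
Proof.
move=> D0 T0 uD; have p0 : 0 < p by apply: lt_trans p2.
have t0 : 0 < T%:R :> R by rewrite ltr0n.
set kap := ucvx_const p; have k0 : 0 < kap by exact: ucvx_const_gt0.
have k1 : kap <= 1 by apply: ucvx_const_le1; exact: ltW.
have sg0 : 0 < stage_radius D T by rewrite divr_gt0// powR_gt0.
set sg := stage_radius D T in sg0.
have sp0 : 0 < sg `^ (p - 2) by rewrite powR_gt0.
have al0 : 0 < stage_rate D T by rewrite divr_gt0 ?mulr_gt0.
set al := stage_rate D T in al0 *.
have alE : 2 * al * L = kap * sg `^ (p - 2).
  by rewrite /al /stage_rate -/kap -/sg; field; exact: lt0r_neq0.
have hE s : 0 <= s -> 2 * al * L * s ^+ 2 <= kap * s `^ p + kap * sg `^ p.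
  move=> s0; rewrite alE -mulrA -mulrDr; apply: ler_wpM2l; first exact: ltW.
  by apply: quadratic_le_powR => //; exact: ltW.
have [pre [v [z [y [tr sz [b [I1 I2 I3]]]]]]] :=
  accelerate_trace p2 L0 adm G0 cG vG T K al0 hE (accelerated_invariant0 f G c p2 al (kap * sg `^ p)).
exists pre, y; split => //.
move: I1 I2 I3; rewrite add0n; set W := weight al T => I1 I2 I3.
have W0 : 0 < W by rewrite /W /weight mulr_gt0// divr_gt0// mulr_gt0// addr_gt0.
have sgp : sg `^ p = D `^ p / T%:R.
  rewrite /sg /stage_radius powRM ?invr_ge0 ?powR_ge0 ?(ltW D0)//; congr (_ * _).
  by rewrite -powRN -powRrM mulNr mulVf ?gt_eqF// powR_inv1// ltW.
have h1 : W * (f y + G y - (f u + G u)) <= 2 * D `^ p.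
  have h2 := I3 u; have h3 := I1 u.
  have h4 : powsum p (u - c) <= D `^ p by rewrite -lpnorm_le// ltW.
  have h5 : T%:R * (kap * sg `^ p) = kap * D `^ p.
    by rewrite sgp; field; exact: lt0r_neq0.
  have h6 : kap * D `^ p <= D `^ p by rewrite ler_piMl// powR_ge0.
  move: I2 h2; rewrite h5 /model mulrBr [W * (f u + _)]mulrDr; lra.
have WT : al * T%:R ^+ 2 / 2 <= W.
  by rewrite /W /weight -mulrA ler_wpM2l ?(ltW al0)// ler_wpM2r// expr2 mulrDr lerDl mulr1 ltW.
have DE : D `^ p = sg `^ (p - 2) * D ^+ 2 * (T%:R / T%:R `^ (2 / p)).
  have : sg `^ p = sg `^ (p - 2) * sg ^+ 2 by apply: powR_sqr_split; exact: ltW.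
  rewrite sgp => /(congr1 (fun a => a * T%:R)); rewrite divfK ?gt_eqF// => ->.
  rewrite {2}/sg /stage_radius expr_div_n -[T%:R `^ p^-1 ^+ 2]powR_mulrn ?powR_ge0//.
  by rewrite -powRrM [p^-1 * 2]mulrC; field; rewrite gt_eqF// powR_gt0.
have TE : T%:R `^ (1 + 2 / p) = T%:R * T%:R `^ (2 / p).
  by rewrite powRD ?(gt_eqF t0) ?implybT// powRr1// ltW.
have q0 : 0 < T%:R `^ (2 / p) by rewrite powR_gt0.
rewrite TE -(ler_pM2l W0); apply: le_trans h1 _.
apply: (@le_trans _ _ (al * T%:R ^+ 2 / 2 * (8 * L * D ^+ 2 / (kap * (T%:R * T%:R `^ (2 / p)))))); last first.
  apply: ler_wpM2r => //; apply: ltW; apply: divr_gt0.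
    by rewrite !mulr_gt0// exprn_gt0.
  by rewrite !mulr_gt0.
rewrite DE.
have -> : al * T%:R ^+ 2 / 2 * (8 * L * D ^+ 2 / (kap * (T%:R * T%:R `^ (2 / p)))) =
   (2 * al * L) * 2 * D ^+ 2 * T%:R / (kap * T%:R `^ (2 / p)).
  by field; rewrite !gt_eqF.
rewrite alE.
have -> : kap * sg `^ (p - 2) * 2 * D ^+ 2 * T%:R / (kap * T%:R `^ (2 / p)) =
  2 * (sg `^ (p - 2) * D ^+ 2 * (T%:R / T%:R `^ (2 / p))).
  by field; rewrite !gt_eqF.
exact: lexx.
Qed.

End one_stage.

(** * Successive regularizations *)

Section regularized_stages.
Variables (R : realType) (d : nat) (p L r eps : R).
Hypotheses (p2 : 2 < p) (L0 : 0 < L) (r0 : 0 < r) (eps0 : 0 < eps).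
Implicit Types (x y z u v c : 'rV[R]_d) (f : 'rV[R]_d -> R) (h : seq (R * 'rV[R]_d)).

Definition stage_dist (s : nat) : R := 2 * r / 4 ^+ s.
(** The share of stage s in the dual norm of the final gradient, up to the
    factor p 2^(p-1); with this factor the shares add up to at most eps / 2.
    *)
Definition tilt (s : nat) : R := eps / (p * 2 `^ (p + 1) * 2 ^+ s).
(** Chosen so that the gradient of coefficient s * powsum, at distance
    stage_dist s, has dual norm of order tilt s. *)
Definition coefficient (s : nat) : R := tilt s / stage_dist s `^ (p - 1).
(** With this constant the accuracy reached by stage s is exactly what uniform
    convexity needs to divide the distance by 4 in [stage_contracts]. *)
Definition stage_const : R := 8 * 4 `^ p / ucvx_const p ^+ 2.
Definition budget (s : nat) : R :=
  (stage_const * (L * stage_dist s / tilt s)) `^ (p / (p + 2)).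
Definition stage_length (s : nat) : nat := (Num.truncn (budget s)).+1.

Let p1 : 1 < p. Proof. by apply: lt_trans p2; rewrite ltr1n. Qed.
Let p0 : 0 < p. Proof. exact: lt_trans p1. Qed.

Lemma stage_dist_gt0 s : 0 < stage_dist s.
Proof. by rewrite divr_gt0 ?mulr_gt0// exprn_gt0. Qed.
Lemma stage_distS s : stage_dist s.+1 = stage_dist s / 4.
Proof. by rewrite /stage_dist exprS; field; rewrite expf_neq0. Qed.
Lemma tilt_gt0 s : 0 < tilt s.
Proof. by rewrite divr_gt0// !mulr_gt0 ?powR_gt0 ?exprn_gt0. Qed.
Lemma tiltS s : tilt s.+1 = tilt s / 2.
Proof. by rewrite /tilt exprS; field; rewrite !expf_neq0 ?gt_eqF ?powR_gt0. Qed.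
Lemma coefficient_gt0 s : 0 < coefficient s.
Proof. by rewrite divr_gt0 ?tilt_gt0// powR_gt0// stage_dist_gt0. Qed.
Lemma stage_const_ge16 : 16 <= stage_const.
Proof.
have k0 : 0 < ucvx_const p :> R by exact: ucvx_const_gt0.
have k1 := ucvx_const_le1 (ltW p2).
have h14 : 1 <= 4 :> R by rewrite ler1n.
have h4 : 4 <= (4 : R) `^ p by have := ler_powR h14 (ltW p1); rewrite powRr1.
rewrite /stage_const ler_pdivlMr ?exprn_gt0//.
have : ucvx_const p ^+ 2 <= 1 by rewrite exprn_ile1// ltW.
lra.
Qed.
Lemma ratio_gt0 s : 0 < stage_const * (L * stage_dist s / tilt s).
Proof.
apply: mulr_gt0; first exact: lt_le_trans stage_const_ge16.
by apply: divr_gt0; [apply: mulr_gt0 => //; exact: stage_dist_gt0 | exact: tilt_gt0].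
Qed.
Lemma budget_ge0 s : 0 <= budget s. Proof. exact: powR_ge0. Qed.

(** The ratio L stage_dist / tilt is halved and raised to a power greater than
    1/2, and the square root of 1/2 is less than 3/4. *)
Lemma budgetS s : budget s.+1 <= 3 / 4 * budget s.
Proof.
have pos := ltW (ratio_gt0 s).
rewrite /budget stage_distS tiltS.
have -> : stage_const * (L * (stage_dist s / 4) / (tilt s / 2)) =
  2^-1 * (stage_const * (L * stage_dist s / tilt s)).
  by field; rewrite gt_eqF// tilt_gt0.
rewrite [X in X <= _]powRM// ler_wpM2r ?powR_ge0//.
have e : (3 / 4 : R) = ((9 / 16) `^ 2^-1).
  have -> : 9 / 16 = (3 / 4 : R) `^ 2 by rewrite powR_mulrn//; field.
  by rewrite powRK.
have a2 : 2^-1 <= p / (p + 2).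
  by rewrite ler_pdivlMr ?addr_gt0//; have := p2; lra.
rewrite e; apply: (@le_trans _ _ (2^-1 `^ 2^-1)).
  by apply: ger_powR => //; lra.
by apply: ge0_ler_powR; rewrite ?nnegrE//; lra.
Qed.

(** The stages append their prox term to the list h of regularizers and
    restart from the point just obtained. *)
Fixpoint stages (n s : nat) h c : strategy R d :=
  if n is n'.+1 then
    let h' := (coefficient s, c) :: h in
    accelerate p (regularizer p h') c (stage_rate p L (stage_dist s) (stage_length s))
      (stage_length s) 0 0 c c (fun y => stages n' s.+1 h' y)
  else Output c.

Lemma first_query_stages n s h c : first_query (stages n s h c) = c.
Proof.
case: n => [//|n] /=.
by rewrite -scalerDl subrK scale1r.
Qed.

Lemma regularizer_cons w h x : regularizer p (w :: h) x =
  w.1 * powsum p (x - w.2) + regularizer p h x.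
Proof. by rewrite /regularizer big_cons. Qed.

Lemma regularizer_ge0 h x : (forall w, w \in h -> 0 <= w.1) -> 0 <= regularizer p h x.
Proof.
by move=> h0; rewrite /regularizer big_seq sumr_ge0// => w /h0 w0; rewrite mulr_ge0// powsum_ge0.
Qed.

Lemma regularizer_continuous h : continuous (regularizer p h : 'rV[R]_d -> R).
Proof.
apply: continuous_sum => w x.
apply: (@continuousM _ _ (fun=> w.1) (fun x => powsum p (x - w.2))).
  exact: cst_continuous.
exact: continuous_powsum.
Qed.

Lemma regularizer_convexf h : (forall w, w \in h -> 0 <= w.1) ->
  convexf (regularizer p h : 'rV[R]_d -> R).
Proof.
move=> h0 t x y t01; rewrite /regularizer !mulr_sumr -big_split big_seq [leRHS]big_seq.
apply: ler_sum => w /h0 w0 /=.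
have -> : t *: x + (1 - t) *: y - w.2 = t *: (x - w.2) + (1 - t) *: (y - w.2).
  by apply/rowP => i; rewrite !mxE; ring.
have := ler_wpM2l w0 (powsum_convex (x - w.2) (y - w.2) (ltW p1) t01).
lra.
Qed.

Lemma regularized_argmin f h la c : admissible p L f ->
  (forall w, w \in (la, c) :: h -> 0 <= w.1) -> 0 < la ->
  argmin (fun x => f x + regularizer p ((la, c) :: h) x) !=set0.
Proof.
move=> adm h0 la0; have [_ _ [xs xsm] _] := adm.
apply: (@coercive_argmin _ _ p _ c 0 la (f xs)) => //; first exact: ltW.
  move=> x; apply: (@continuousD _ _ _ f (regularizer p ((la, c) :: h))).
    exact: (admissible_continuous adm).
  exact: regularizer_continuous.
move=> z; rewrite dot0r addr0 regularizer_cons /= addrA.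
rewrite -[leLHS]addr0 lerD ?lerD//.
by apply: regularizer_ge0 => w wh; apply: h0; rewrite inE wh orbT.
Qed.

Lemma regularized_growth f h la c z u : admissible p L f ->
  (forall w, w \in h -> 0 <= w.1) -> 0 <= la ->
  let F := fun x => f x + regularizer p ((la, c) :: h) x in
  argmin F z -> F z + la * ucvx_const p * powsum p (u - z) <= F u.
Proof.
move=> adm h0 la0 F zm.
apply: (@argmin_growth _ _ p (fun x => f x + regularizer p h x) F c la z u (ltW p2) la0) => //.
  move=> t x y t01; have := admissible_convexf adm x y t01.
  have := regularizer_convexf h0 x y t01; lra.
by move=> x; rewrite /F regularizer_cons /=; ring.
Qed.

(** Adding a multiple of N(x - c) to a function minimized at z moves the
    minimizer towards c, so the initial distance is still at most stage_dist
    s. The accuracy given by [one_stage] then controls the distance to the new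
    minimizer by uniform convexity. *)
Lemma stage_contracts f h s c z : admissible p L f ->
  (forall w, w \in h -> 0 <= w.1) ->
  argmin (fun x => f x + regularizer p h x) z -> lpnorm p (c - z) <= stage_dist s ->
  let h' := (coefficient s, c) :: h in
  exists2 z', argmin (fun x => f x + regularizer p h' x) z' /\ lpnorm p (c - z') <= stage_dist s
  & forall K, exists pre y, [/\
    trace f (accelerate p (regularizer p h') c
      (stage_rate p L (stage_dist s) (stage_length s)) (stage_length s) 0 0 c c K)
      = pre ++ trace f (K y),
    size pre = stage_length s
  & lpnorm p (y - z') <= stage_dist s.+1].
Proof.
move=> adm h0 zm cz h'.
have la0 := coefficient_gt0 s.
have h'0 w : w \in h' -> 0 <= w.1.
  by rewrite inE => /orP[/eqP->|/h0//]; exact: ltW.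
have [z' z'm] := regularized_argmin adm h'0 la0.
have D0 := stage_dist_gt0 s.
have cz' : lpnorm p (c - z') <= stage_dist s.
  apply: le_trans cz; have h1 := zm z'; have h2 := z'm z.
  apply: (ler_lpnorm p0).
  move: h2; rewrite /h' !regularizer_cons /= => h2.
  rewrite powsumBC [leRHS]powsumBC -(ler_pM2l la0).
  move: h1 h2; lra.
exists z' => // K.
have T0 : (0 < stage_length s)%N by [].
have z'c : lpnorm p (z' - c) <= stage_dist s by rewrite lpnormB.
have [pre [y [tr sz gap]]] := one_stage p2 L0 adm (fun x => regularizer_ge0 x h'0)
  (@regularizer_continuous h') (regularizer_convexf h'0) K D0 T0 z'c.
exists pre, y; split => //.
have h2 := regularized_growth y adm h0 (ltW la0) z'm.
set kap := ucvx_const p in gap h2; have k0 : 0 < kap by exact: ucvx_const_gt0.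
rewrite lpnorm_le//; last exact/ltW/stage_dist_gt0.
have e0 := tilt_gt0 s.
have T1 : stage_const * (L * stage_dist s / tilt s) <= (stage_length s)%:R `^ (1 + 2 / p).
  have pos := ltW (ratio_gt0 s).
  have -> : stage_const * (L * stage_dist s / tilt s) = budget s `^ (1 + 2 / p).
    rewrite /budget -powRrM.
    have -> : p / (p + 2) * (1 + 2 / p) = 1.
      by field; rewrite !gt_eqF// addr_gt0.
    by rewrite powRr1.
  rewrite ge0_ler_powR ?nnegrE ?budget_ge0//.
    by rewrite addr_ge0// divr_ge0// ltW.
  by rewrite /stage_length ltW// truncnS_gt.
have TT0 := ratio_gt0 s.
have h3 : coefficient s * kap * powsum p (y - z') <=
    8 * L * stage_dist s ^+ 2 / (kap * (stage_const * (L * stage_dist s / tilt s))).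
  have h4 : f y + regularizer p h' y - (f z' + regularizer p h' z') <=
     8 * L * stage_dist s ^+ 2 / (kap * (stage_const * (L * stage_dist s / tilt s))).
    apply: le_trans gap _; apply: ler_wpM2l.
      by apply: ltW; rewrite !mulr_gt0// exprn_gt0.
    rewrite lef_pV2 ?posrE; first by apply: ler_wpM2l => //; exact: ltW.
      by apply: mulr_gt0 => //; exact: powR_gt0.
    exact: mulr_gt0.
  by apply: le_trans h4; rewrite lerBrDl.
have ck0 : 0 < coefficient s * kap by rewrite mulr_gt0.
rewrite -(ler_pM2l ck0); apply: le_trans h3 _.
rewrite stage_distS /coefficient.
have -> : (stage_dist s / 4) `^ p = stage_dist s * stage_dist s `^ (p - 1) / 4 `^ p.
  rewrite powRM ?invr_ge0 ?(ltW D0)// mulr_powRB1 ?(ltW D0)//; congr (_ * _).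
  by rewrite -powR_inv1// -powRrM mulrC powRrM powR_inv1// powR_ge0.
have q0 : 0 < stage_dist s `^ (p - 1) by rewrite powR_gt0.
have q4 : 0 < (4 : R) `^ p by rewrite powR_gt0.
rewrite /stage_const -/kap le_eqVlt; apply/orP; left; apply/eqP.
by field; rewrite !gt_eqF.
Qed.

(** Induction on the stages to come. B bounds the tilts already spent, and the
    slack 4 * stage_dist s absorbs all the later moves of the minimizer: the
    next one is at most 2 * stage_dist s, and the slack drops by three
    quarters. The cost is dominated by the first stage because the budgets
    decrease geometrically. *)
Lemma stages_trace f n s h c z (B : R) : admissible p L f ->
  (forall w, w \in h -> 0 <= w.1) ->
  argmin (fun x => f x + regularizer p h x) z -> lpnorm p (c - z) <= stage_dist s ->
  \sum_(w <- h) w.1 * (lpnorm p (z - w.2) + 4 * stage_dist s) `^ (p - 1) <= 2 `^ (p - 1) * B ->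
  (forall j, (s <= j < s + n)%N -> 1 <= budget j) ->
  let t := trace f (stages n s h c) in
  (size t)%:R <= 1 + 8 * budget s /\
  lpnorm (conjugate_exponent p) (gradient f (last 0 t)) <=
    p * (2 `^ (p - 1) * (B + 2 * tilt s)) + 5 * L * stage_dist (s + n).
Proof.
have aux (a b D : R) : 0 < D -> a <= D + D + b -> a + D <= b + 4 * D by lra.
have aux2 (a D : R) : 0 < D -> a <= D -> a + D <= 2 * D by lra.
have aux3 (T b b' t : R) : T <= 2 * b -> b' <= 3 / 4 * b -> t <= 1 + 8 * b' ->
  T + t <= 1 + 8 * b by lra.
have aux4 (b t : R) : t <= b -> 1 <= b -> t + 1 <= 2 * b by lra.
move=> adm; elim: n s h c z B => [|n IH] s h c z B h0 zm cz hB hb.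
  rewrite /= addn0; split; first by rewrite lerDl mulr_ge0// budget_ge0.
  have D40 : 0 < 4 * stage_dist s by rewrite mulr_gt0// stage_dist_gt0.
  have h1 := gradient_at_regularized_min p2 L0 adm h0 D40 zm.
  have h2 := gradient_lip p2 adm c z.
  have h3 := ler_wpM2l (ltW p0) hB.
  have h4 := ler_wpM2l (ltW L0) cz.
  have h5 : 0 <= p * (2 `^ (p - 1) * (2 * tilt s)).
    apply: mulr_ge0; [exact: ltW | apply: mulr_ge0; [exact: powR_ge0|]].
    by apply: mulr_ge0 => //; exact/ltW/tilt_gt0.
  apply: le_trans h2 (le_trans (lerD h1 h4) _).
  have e : L * (4 * stage_dist s) + L * stage_dist s = 5 * L * stage_dist s by ring.
  rewrite -addrA e lerD2r; apply: le_trans h3 _.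
  by rewrite (mulrDr (2 `^ (p - 1))) (mulrDr p) lerDl.
have [z' [z'm cz'] hK] := stage_contracts adm h0 zm cz.
set h' := (coefficient s, c) :: h in z'm hK.
have [pre [y [tr sz yz']]] := hK (fun y => stages n s.+1 h' y).
have h'0 w : w \in h' -> 0 <= w.1.
  by rewrite inE => /orP[/eqP->|/h0//]; exact/ltW/coefficient_gt0.
have D0 := stage_dist_gt0 s.
have pp : 0 <= p - 1 by rewrite subr_ge0 ltW.
have D40 : 0 <= 4 * stage_dist s by apply: mulr_ge0 => //; exact: ltW.
have D20 : 0 <= 2 * stage_dist s by apply: mulr_ge0 => //; exact: ltW.
have hB' : \sum_(w <- h') w.1 * (lpnorm p (z' - w.2) + 4 * stage_dist s.+1) `^ (p - 1)
    <= 2 `^ (p - 1) * (B + tilt s).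
  rewrite big_cons /= stage_distS.
  have -> : 4 * (stage_dist s / 4) = stage_dist s by field.
  rewrite mulrDr addrC lerD//.
    apply: le_trans hB; rewrite big_seq [leRHS]big_seq; apply: ler_sum => w wh.
    apply: ler_wpM2l; first exact: h0.
    apply: ge0_ler_powR; rewrite ?nnegrE// ?addr_ge0 ?lpnorm_ge0 ?D40 ?D20 ?(ltW D0)//.
    have z'c : lpnorm p (z' - c) <= stage_dist s by rewrite lpnormB.
    have z'z : lpnorm p (z' - z) <= stage_dist s + stage_dist s.
      exact: le_trans (lpnorm_tri z' c z (ltW p1)) (lerD z'c cz).
    have z'w : lpnorm p (z' - w.2) <= stage_dist s + stage_dist s + lpnorm p (z - w.2).
      by apply: le_trans (lpnorm_tri z' z w.2 (ltW p1)) _; rewrite lerD2r.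
    exact: aux.
  rewrite lpnormB; apply: (@le_trans _ _ (coefficient s * (2 * stage_dist s) `^ (p - 1))).
    apply: ler_wpM2l; first exact/ltW/coefficient_gt0.
    apply: ge0_ler_powR; rewrite ?nnegrE// ?addr_ge0 ?lpnorm_ge0 ?D40 ?D20 ?(ltW D0)//.
    exact: aux2.
  rewrite powRM ?(ltW D0)// /coefficient le_eqVlt; apply/orP; left; apply/eqP.
  by field; rewrite gt_eqF// powR_gt0.
have hb' j : (s.+1 <= j < s.+1 + n)%N -> 1 <= budget j.
  by move=> /andP[h1 h2]; apply: hb; rewrite (ltnW h1) addnS -addSn.
have [IH1 IH2] := IH _ _ _ _ _ h'0 z'm yz' hB' hb'.
move=> t; have tE : t = pre ++ trace f (stages n s.+1 h' y) by [].
rewrite tE size_cat last_cat; split; last first.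
  have -> : last (last 0 pre) (trace f (stages n s.+1 h' y)) = last 0 (trace f (stages n s.+1 h' y)).
    by have := trace_gt0 f (stages n s.+1 h' y); case: (trace _ _).
  apply: le_trans IH2 _; rewrite addnS -addSn tiltS.
  have -> : B + tilt s + 2 * (tilt s / 2) = B + 2 * tilt s by field.
  exact: lexx.
have b1 : 1 <= budget s by apply: hb; rewrite leqnn addnS ltnS leq_addr.
have b2 : (stage_length s)%:R <= 2 * budget s.
  rewrite /stage_length -natr1; apply: aux4 => //.
  by rewrite truncn_le// budget_ge0.
by rewrite natrD sz; apply: aux3 b2 (budgetS s) IH1.
Qed.

End regularized_stages.

(** * The upper bound *)

Section upper_bound.
Variable R : realType.

Lemma strategy_returns d (s : strategy R d) x0 : first_query s = x0 ->
  exists A : algorithm x0, forall f,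
    returns A f (size (trace f s)) (last 0 (trace f s)).
Proof. by move=> <-; exists (strategy_algorithm s) => f; exact: returns_strategy. Qed.

(** The factor 2 makes room for a point that does not attain the distance. *)
Lemma lpdist_near d (p r : R) (x0 : 'rV[R]_d) (X : set 'rV[R]_d) : 0 < r ->
  X !=set0 -> lpdist p x0 X <= r -> exists2 u, X u & lpnorm p (x0 - u) <= 2 * r.
Proof.
move=> r0 [u0 Xu0] hd; apply: contrapT => /forall2NP hN.
have : 2 * r <= lpdist p x0 X.
  apply: lb_le_inf; first by exists (lpnorm p (x0 - u0)), u0.
  move=> _ [u Xu <-]; have [//|/negP] := hN u.
  by rewrite -ltNge => /ltW.
lra.
Qed.

Lemma stage_dist_le_eps (L r eps : R) : 0 < L -> 0 < r -> 0 < eps ->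
  exists n, 10 * L * stage_dist r n <= eps.
Proof.
move=> L0 r0 e0; pose y := 20 * L * r / eps.
have y0 : 0 <= y by rewrite divr_ge0 ?mulr_ge0 ?ltW.
exists (Num.truncn y).+1; rewrite /stage_dist.
have h4 n : n%:R <= 4 ^+ n :> R.
  by rewrite -natrX ler_nat ltnW// ltn_expl.
have hy : y <= 4 ^+ (Num.truncn y).+1.
  by apply: le_trans (h4 _); rewrite ltW// truncnS_gt.
have p4 : 0 < (4 : R) ^+ (Num.truncn y).+1 by rewrite exprn_gt0.
have -> : 10 * L * (2 * r / 4 ^+ (Num.truncn y).+1) = y * eps / 4 ^+ (Num.truncn y).+1.
  by rewrite /y; field; rewrite !gt_eqF.
by rewrite ler_pdivrMr// mulrC ler_wpM2l// ltW.
Qed.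

Lemma upper_bound (p : R) : 2 < p -> exists Cp : R,
  forall (d : nat) (L r eps : R) (x0 : 'rV[R]_d),
    0 < L -> 0 < r -> 0 < eps ->
    exists A : algorithm x0,
      forall f : 'rV[R]_d -> R,
        admissible p L f -> lpdist p x0 (argmin f) <= r ->
        exists (n : nat) (xhat : 'rV[R]_d),
          [/\ returns A f n xhat,
              lpnorm (conjugate_exponent p) (gradient f xhat) <= eps
            & n%:R <= Cp * (1 + (L * r / eps) `^ (p / (p + 2)))].
Proof.
move=> p2; have p0 : 0 < p by apply: lt_trans p2.
pose C3 := stage_const p * (2 * p * 2 `^ (p + 1)).
pose a := p / (p + 2).
exists (1 + 8 * C3 `^ a) => d L r eps x0 L0 r0 eps0.
(* The first S for which the Lipschitz terms left over at the end, 5 L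
   stage_dist S in total, take at most eps / 2. Minimality keeps all budgets
   above 1, so that rounding them up at most doubles the cost. *)
have [S SP Smin] := ex_minnP (stage_dist_le_eps L0 r0 eps0).
have c16 : 16 <= stage_const p by apply: stage_const_ge16.
have c0 : 0 < stage_const p by apply: lt_le_trans c16.
have pw8 : 8 <= 2 `^ (p + 1) :> R.
  have -> : 8 = 2 `^ 3%:R :> R by rewrite powR_mulrn// -natrX.
  by apply: ler_powR; [rewrite ler1n | move: p2; clear; lra].
have c10 : 10 <= stage_const p by apply: le_trans c16; rewrite ler_nat.
have pw0 : 0 < 2 `^ (p + 1) :> R by apply: lt_le_trans pw8.
have hb j : (0 <= j < 0 + S)%N -> 1 <= budget p L r eps j.
  move=> /andP[_ jS]; have D0 := stage_dist_gt0 r0 j.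
  have big : eps < 10 * L * stage_dist r j.
    by rewrite ltNge; apply/negP => /Smin; rewrite leqNgt jS.
  have t0 := tilt_gt0 p2 eps0 j.
  have te : tilt p eps j <= eps.
    rewrite /tilt ler_pdivrMr ?mulr_gt0 ?exprn_gt0//.
    rewrite ler_peMr ?(ltW eps0)// -[leLHS]mulr1.
    apply: ler_pM => //; last by rewrite exprn_ege1// ler1n.
    by move: p2 pw8 pw0; clear; nra.
  have -> : 1 = 1 `^ (p / (p + 2)) :> R by rewrite powR1.
  apply: ge0_ler_powR; rewrite ?nnegrE//.
  - by rewrite divr_ge0 ?addr_ge0 ?(ltW p0).
  - exact: ltW (ratio_gt0 p2 L0 r0 eps0 j).
  rewrite mulrA ler_pdivlMr// mul1r; apply: le_trans te _; apply: le_trans (ltW big) _.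
  rewrite -mulrA; apply: ler_wpM2r; first by rewrite mulr_ge0 ?ltW.
  exact: c10.
have a0 : 0 <= a by rewrite /a divr_ge0 ?addr_ge0 ?(ltW p0).
have K0 : 0 <= L * r / eps by rewrite divr_ge0 ?mulr_ge0// ltW.
have C30 : 0 <= C3 by apply: ltW; apply: mulr_gt0 => //; rewrite !mulr_gt0.
have b0 : budget p L r eps 0 = C3 `^ a * (L * r / eps) `^ a.
  rewrite /budget -powRM//; congr (_ `^ _).
  by rewrite /C3 /stage_dist /tilt !expr0; field; rewrite !gt_eqF.
have [A HA] := strategy_returns (first_query_stages p L r eps S 0 [::] x0).
exists A => f adm hd.
have [_ _ X0 _] := adm.
have [u um ud] := lpdist_near r0 X0 hd.
have um' : argmin (fun x => f x + regularizer p [::] x) u.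
  by move=> y; rewrite /regularizer !big_nil !addr0; exact: um.
have ud' : lpnorm p (x0 - u) <= stage_dist r 0 by rewrite /stage_dist expr0 divr1.
have hB : \sum_(w <- [::] : seq (R * 'rV[R]_d)) w.1 * (lpnorm p (u - w.2) + 4 * stage_dist r 0) `^ (p - 1)
  <= 2 `^ (p - 1) * 0 by rewrite big_nil mulr0.
have [] := stages_trace p2 L0 r0 eps0 adm _ um' ud' hB hb => //.
rewrite add0n => h1 h2.
exists (size (trace f (stages p L r eps S 0 [::] x0))), (last 0 (trace f (stages p L r eps S 0 [::] x0))).
split; first exact: HA.
  apply: le_trans h2 _; rewrite add0r.
  have -> : p * (2 `^ (p - 1) * (2 * tilt p eps 0)) = eps / 2.
    have -> : 2 `^ (p - 1) = 2 `^ (p + 1) / 4 :> R.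
      have -> : p + 1 = (p - 1) + 2 by ring.
      rewrite (@powRD _ 2 (p - 1) 2) ?pnatr_eq0 ?implybT// (powR_mulrn 2 (ler0n _ 2)) expr2.
      by field.
    by rewrite /tilt expr0; field; rewrite !gt_eqF.
  move: SP; clear; lra.
apply: le_trans h1 _; rewrite b0.
have x1 := powR_ge0 C3 a; have x2 := powR_ge0 (L * r / eps) a.
move: (C3 `^ a) (_ `^ a) x1 x2 => X Y; clear; nra.
Qed.

End upper_bound.

(** * The smoothed maximum *)

Section smoothed_maximum.
Variables (R : realType) (d : nat) (s c : R).
Hypotheses (s2 : 2 <= s) (c0 : 0 < c).
Implicit Types (x y z u v l m : 'rV[R]_d).

Let s1 : 1 < s. Proof. by apply: lt_le_trans s2; rewrite ltr1n. Qed.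
Let q := conjugate_exponent s.

Lemma conj_exp_le2 : q <= 2.
Proof. by rewrite /q /conjugate_exponent ler_pdivrMr ?subr_gt0//; have := s2; lra. Qed.
Let q1 : 1 < q. Proof. exact: conj_exp_gt1. Qed.
Let q0 : 0 < q. Proof. exact: lt_trans q1. Qed.

(** The missing mass 1 - sum l is the weight of the constant 0; it gives the
    smoothed maximum a floor, hence minimizers. *)
Definition simplex : set 'rV[R]_d :=
  [set l | (forall i, 0 <= l 0 i) /\ \sum_i l 0 i <= 1].

(** The smoothed maximum of y and 0 is the maximum over the simplex of this
    concave function; its penalty is strongly convex in the l_q norm, with a
    constant of order q - 1. *)
Definition penalized y l : R := dotr l y - c * powsum q l.

Lemma simplex_le1 l i : simplex l -> l 0 i <= 1.
Proof.
case=> l0; apply: le_trans; rewrite (bigD1 i)//= lerDl.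
by apply: sumr_ge0 => j _.
Qed.

Lemma simplex0 : simplex 0.
Proof. by split => [i|]; rewrite ?mxE// big1// => i _; rewrite mxE. Qed.

Lemma simplex_conv l m (t : R) : 0 <= t <= 1 -> simplex l -> simplex m ->
  simplex (l + t *: (m - l)).
Proof.
move=> /andP[t0 t1] [l0 l1] [m0 m1]; have t1' : 0 <= 1 - t by rewrite subr_ge0.
have e i : (l + t *: (m - l)) 0 i = (1 - t) * l 0 i + t * m 0 i by rewrite !mxE; ring.
split => [i|]; first by rewrite e addr_ge0// mulr_ge0.
under eq_bigr do rewrite e.
rewrite big_split -!mulr_sumr /=.
have h1 := ler_wpM2l t1' l1; have h2 := ler_wpM2l t0 m1; lra.
Qed.

Lemma simplex_compact : compact simplex.
Proof.
apply: bounded_closed_compact.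
  apply: (@bounded_coordinates R d simplex 1) => l ls i.
  by rewrite ger0_norm; [exact: simplex_le1 | case: ls].
have -> : simplex = \bigcap_i [set l : 'rV[R]_d | 0 <= l 0 i] `&` [set l : 'rV[R]_d | \sum_i l 0 i <= 1].
  by apply/seteqP; split => l /= [h1 h2]; split => // i; [move=> _|]; exact: h1.
apply: closedI.
  apply: closed_bigI => i _.
  have -> : [set l : 'rV[R]_d | 0 <= l 0 i] = (fun l : 'rV[R]_d => l 0 i) @^-1` [set y | 0 <= y] by [].
  by apply: preimage_closed; [move=> x _; exact: coord_continuous | exact: closed_ge].
have -> : [set l : 'rV[R]_d | \sum_i l 0 i <= 1] =
    (fun l : 'rV[R]_d => \sum_i l 0 i) @^-1` [set y | y <= 1] by [].
apply: preimage_closed; last exact: closed_le.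
by move=> x _; apply: continuous_sum => i; exact: coord_continuous.
Qed.

Lemma penalized_continuous y : continuous (penalized y).
Proof.
have -> : penalized y = fun l => dotr y l - c * powsum q (l - 0).
  by apply/funext => l; rewrite /penalized dotrC subr0.
move=> l; apply: (@continuousB _ _ _ (dotr y) (fun l => c * powsum q (l - 0))).
  exact: continuous_dotr.
apply: (@continuousM _ _ (fun=> c) (fun l => powsum q (l - 0))).
  exact: cst_continuous.
exact: continuous_powsum.
Qed.

Lemma penalized_max y : exists2 l, simplex l & forall m, simplex m -> penalized y m <= penalized y l.
Proof.
have sn : simplex !=set0 by exists 0; exact: simplex0.
have [l] := EVT_max_rV sn simplex_compact (continuous_subspaceT (@penalized_continuous y)).
rewrite in_setE => ls lm; exists l => // m ms; apply: lm; by rewrite in_setE.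
Qed.

Definition smax_arg y : 'rV[R]_d :=
  xget 0 [set l | simplex l /\ forall m, simplex m -> penalized y m <= penalized y l].

Definition smax y : R := penalized y (smax_arg y).

Lemma smax_argP y : simplex (smax_arg y) /\
  forall m, simplex m -> penalized y m <= smax y.
Proof.
rewrite /smax /smax_arg; case: xgetP => [l -> //|/=].
by have [l ls lm] := penalized_max y; move=> /(_ l); case.
Qed.

Lemma smax_arg_simplex y : simplex (smax_arg y). Proof. by case: (smax_argP y). Qed.
Lemma smax_arg_ge0 y i : 0 <= smax_arg y 0 i. Proof. by case: (smax_arg_simplex y). Qed.
Lemma smax_arg_le1 y i : smax_arg y 0 i <= 1.
Proof. exact/simplex_le1/smax_arg_simplex. Qed.

(** Optimality along the segment from l to m: the tangent inequality taken at
    l + t (m - l) bounds the linear gain by the slope of the penalty there,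
    and t goes to 0. *)
Lemma smax_arg_variational y m : simplex m ->
  let l := smax_arg y in
  dotr (m - l) y <= c * q * \sum_i (m - l) 0 i * (l 0 i) `^ (q - 1).
Proof.
move=> ms; cbv zeta; set l := smax_arg y; set w := m - l.
have ls : simplex l := smax_arg_simplex y.
pose phi (t : R) : R := c * q * \sum_i w 0 i * `|l 0 i + t * w 0 i| `^ (q - 1).
have -> : c * q * \sum_i w 0 i * l 0 i `^ (q - 1) = phi 0.
  rewrite /phi; congr (_ * _); apply: eq_bigr => i _.
  by rewrite mul0r addr0 ger0_norm; last by case: ls.
have hphi t : 0 < t -> t <= 1 -> dotr w y <= phi t.
  move=> t0 t1; have t01 : 0 <= t <= 1 by rewrite (ltW t0) t1.
  have lt := simplex_conv t01 ls ms.
  have [_ /(_ _ lt)] := smax_argP y; rewrite -/w /smax -/l /penalized dotrDl dotrZl.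
  move=> h; rewrite -(ler_pM2l t0).
  have h2 : powsum q (l + t *: w) - powsum q l <= t * (q * \sum_i w 0 i * `|l 0 i + t * w 0 i| `^ (q - 1)).
    rewrite /powsum -sumrB !mulr_sumr; apply: ler_sum => i _.
    have := powR_tangent (ltW q1) (normr_ge0 ((l + t *: w) 0 i)) (normr_ge0 (l 0 i)).
    have e : (l + t *: w) 0 i = l 0 i + t * w 0 i by rewrite !mxE.
    have p0 : 0 <= (l + t *: w) 0 i by case: lt.
    have p1 : 0 <= l 0 i by case: ls.
    rewrite e in p0 *; rewrite (ger0_norm p0) (ger0_norm p1).
    have -> : l 0 i - (l 0 i + t * w 0 i) = - (t * w 0 i) by ring.
    move: (_ `^ q) (_ `^ q) (_ `^ (q - 1)) => X Y Z hh.
    have -> : t * (q * (w 0 i * Z)) = - (q * Z * (- (t * w 0 i))) by ring.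
    by rewrite lerBlDr -lerBlDl opprK.
  have h3 := ler_wpM2l (ltW c0) h2.
  rewrite /phi.
  have -> : t * (c * q * \sum_i w 0 i * `|l 0 i + t * w 0 i| `^ (q - 1)) =
     c * (t * (q * \sum_i w 0 i * `|l 0 i + t * w 0 i| `^ (q - 1))) by ring.
  apply: le_trans h3; rewrite mulrBr; move: h.
  move: (powsum q _) (powsum q _) (dotr l y) (dotr w y) => X Y Z V; lra.
rewrite leNgt; apply/negP => hlt.
have cphi : {for 0, continuous phi}.
  apply: (@continuousM _ _ (fun=> c * q)); first exact: cst_continuous.
  apply: continuous_sum => i t.
  apply: (@continuousM _ _ (fun=> w 0 i) 
    (fun t : R => `|l 0 i + t * w 0 i| `^ (q - 1))); first exact: cst_continuous.
  apply: (@continuous_comp _ _ _ (fun t : R => l 0 i + t * w 0 i) (fun y : R => `|y| `^ (q - 1))).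
    apply: (@continuousD _ _ _ (fun=> l 0 i) (fun t : R => t * w 0 i)); first exact: cst_continuous.
    by apply: (@continuousM _ _ (fun t : R => t) (fun=> w 0 i)); [exact: cvg_id | exact: cst_continuous].
  by apply: continuous_norm_powR; rewrite subr_gt0.
have hr : \forall t \near (0 : R)^'+, phi t < dotr w y.
  exact: cvgr_lt (cvg_at_right_filter cphi) _ hlt.
have [t [h1 h0 hl]] : exists t : R, [/\ phi t < dotr w y, 0 < t & t < 1].
  near (0 : R)^'+ => t; exists t; split.
  - by near: t; exact: hr.
  - by near: t; exact: nbhs_right_gt.
  - by near: t; apply: nbhs_right_lt; exact: ltr01.
by have := hphi t h0 (ltW hl); rewrite leNgt h1.
Unshelve. all: by end_near.
Qed.

(** Otherwise moving the mass of j to i would pay: the slope of the penalty is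
    at most c q on the simplex. *)
Lemma smax_arg_eq0 y i j : c * q < y 0 i - y 0 j -> smax_arg y 0 j = 0.
Proof.
move=> gap; set l := smax_arg y.
have ls : simplex l := smax_arg_simplex y.
have lj := smax_arg_ge0 y j; rewrite -/l in lj.
have ij : i != j by apply: contraTneq gap => ->; rewrite subrr -leNgt mulr_ge0// ltW.
pose m := l + l 0 j *: (delta_mx 0 i - delta_mx 0 j).
have mE k : m 0 k = l 0 k + l 0 j * ((k == i)%:R - (k == j)%:R).
  by rewrite !mxE eqxx.
have sumE (k : 'I_d) (F : 'I_d -> R) : \sum_i0 (i0 == k)%:R * F i0 = F k.
  rewrite (bigD1 k)//= eqxx mul1r big1 ?addr0// => k' /negbTE ->.
  by rewrite mul0r.
have sum1 (k : 'I_d) : \sum_i0 (i0 == k)%:R = 1 :> R.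
  by rewrite (bigD1 k)//= eqxx big1 ?addr0// => k' /negbTE ->.
have ms : simplex m.
  have [l0 l1] := ls; split => [k|].
    rewrite mE; have [->|kj] := eqVneq k j; last first.
      by rewrite subr0 addr_ge0// mulr_ge0.
    by rewrite eq_sym (negbTE ij) sub0r mulrN1 subrr.
  under eq_bigr do rewrite mE.
  rewrite big_split -mulr_sumr sumrB /=.
  by rewrite !sum1 subrr mulr0 addr0.
have := smax_arg_variational y ms; rewrite -/l /dotr.
have wE k : (m - l) 0 k = l 0 j * ((k == i)%:R - (k == j)%:R) by rewrite mxE mE mxE addrC addKr.
under eq_bigr do rewrite wE -mulrA mulrBl.
rewrite -mulr_sumr sumrB !sumE.
under eq_bigr do rewrite wE -mulrA mulrBl.
rewrite -mulr_sumr sumrB !sumE => h.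
have l1 : l 0 i `^ (q - 1) <= 1.
  apply: (@le_trans _ _ (1 `^ (q - 1))); last by rewrite powR1.
  apply: ge0_ler_powR; rewrite ?nnegrE ?smax_arg_ge0 ?smax_arg_le1//.
  by rewrite subr_ge0 ltW.
apply/eqP; rewrite eq_le lj andbT leNgt; apply/negP => lj0.
move: h; rewrite mulrCA ler_pM2l// => h.
have cq0 : 0 <= c * q by rewrite mulr_ge0// ltW.
have h2 : c * q * (l 0 i `^ (q - 1) - l 0 j `^ (q - 1)) <= c * q * 1.
  by apply: ler_wpM2l => //; rewrite lerBlDr (le_trans l1)// lerDl powR_ge0.
by move: gap; rewrite ltNge (le_trans h)// (le_trans h2)// mulr1.
Qed.

(** Otherwise giving the missing mass to i would pay. *)
Lemma smax_arg_mass y i : c * q < y 0 i -> \sum_j smax_arg y 0 j = 1.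
Proof.
move=> gap; set l := smax_arg y.
have ls : simplex l := smax_arg_simplex y; have [l0 l1] := ls.
set e := 1 - \sum_j l 0 j.
have e0 : 0 <= e by rewrite subr_ge0.
pose m := l + e *: delta_mx 0 i.
have mE k : m 0 k = l 0 k + e * (k == i)%:R by rewrite !mxE eqxx.
have sumE (F : 'I_d -> R) : \sum_k (k == i)%:R * F k = F i.
  rewrite (bigD1 i)//= eqxx mul1r big1 ?addr0// => k' /negbTE ->.
  by rewrite mul0r.
have sum1 : \sum_k (k == i)%:R = 1 :> R.
  by rewrite (bigD1 i)//= eqxx big1 ?addr0// => k' /negbTE ->.
have ms : simplex m.
  split => [k|]; first by rewrite mE addr_ge0// mulr_ge0.
  under eq_bigr do rewrite mE.
  rewrite big_split -mulr_sumr /=.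
  by rewrite sum1 mulr1 /e subrKC.
have := smax_arg_variational y ms; rewrite -/l /dotr.
have wE k : (m - l) 0 k = e * (k == i)%:R by rewrite mxE mE mxE addrC addKr.
under eq_bigr do rewrite wE -mulrA.
rewrite -mulr_sumr sumE.
under eq_bigr do rewrite wE -mulrA.
rewrite -mulr_sumr sumE => h.
have li1 : l 0 i `^ (q - 1) <= 1.
  apply: (@le_trans _ _ (1 `^ (q - 1))); last by rewrite powR1.
  apply: ge0_ler_powR; rewrite ?nnegrE ?smax_arg_ge0 ?smax_arg_le1//.
  by rewrite subr_ge0 ltW.
suff : e = 0 by rewrite /e => /eqP; rewrite subr_eq0 => /eqP.
apply/eqP; rewrite eq_le e0 andbT leNgt; apply/negP => e1.
move: h; rewrite mulrCA ler_pM2l// => h.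
have cq0 : 0 <= c * q by rewrite mulr_ge0// ltW.
have := ler_wpM2l cq0 li1; rewrite mulr1 => h2.
by move: gap; rewrite ltNge (le_trans h).
Qed.

End smoothed_maximum.

(** * Regularity of the smoothed maximum *)

Section smoothed_maximum_regularity.
Variables (R : realType) (d : nat) (s c : R).
Hypotheses (s2 : 2 <= s) (c0 : 0 < c).
Implicit Types (x y z u v l m : 'rV[R]_d).

Let s1 : 1 < s. Proof. by apply: lt_le_trans s2; rewrite ltr1n. Qed.
Let s0 : 0 < s. Proof. exact: lt_trans s1. Qed.
Let q := conjugate_exponent s.
Let q1 : 1 < q. Proof. exact: conj_exp_gt1. Qed.
Let q0 : 0 < q. Proof. exact: lt_trans q1. Qed.
Let q2 : q <= 2. Proof. exact: conj_exp_le2. Qed.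

Local Notation arg := (smax_arg s c).

(** Concavity of t^(q-1) from the larger argument. The constant is linear in q
    - 1, as the dependence of the final bound on min(p, ln d) requires. *)
Lemma powR_sub_monotone (a b : R) : 0 <= a -> 0 <= b ->
  (q - 1) * (Num.max a b `^ (q - 2) * (a - b) ^+ 2)
    <= (a `^ (q - 1) - b `^ (q - 1)) * (a - b).
Proof.
have key (u v : R) : 0 <= u -> 0 <= v -> v <= u ->
    (q - 1) * (u `^ (q - 2) * (u - v) ^+ 2) <= (u `^ (q - 1) - v `^ (q - 1)) * (u - v).
  move=> u0 v0 vu; move: u0; rewrite le_eqVlt => /orP[/eqP u0|u0].
    have -> : v = u by apply/eqP; rewrite eq_le vu -u0 v0.
    by rewrite subrr expr0n /= !mulr0.
  have r01 : 0 < q - 1 <= 1 by apply/andP; split; have := q1; have := q2; lra.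
  have := powR_concave_tangent r01 u0 v0.
  have -> : q - 1 - 1 = q - 2 by ring.
  have uv : 0 <= u - v by rewrite subr_ge0.
  by move=> /(ler_wpM2r uv); rewrite expr2 !mulrA.
move=> a0 b0; have [ab|/ltW ab] := leP a b; last exact: key.
have -> : (a - b) ^+ 2 = (b - a) ^+ 2 by rewrite !expr2; ring.
by apply: le_trans (key b a b0 a0 ab) _; rewrite le_eqVlt; apply/orP; left; apply/eqP; ring.
Qed.

(** With h = l - m and w their maximum, the coordinates where |h| < eta w
    contribute at most eta^q w to the sum of the |h|^q. Since the w add up to
    at most 2, at least half of that sum comes from the other coordinates when
    eta is a suitable multiple of the norm of h, and there |h|^q is controlled
    by the quadratic term. *)
Lemma simplex_strong_monotone l m : simplex l -> simplex m ->
  lpnorm q (l - m) ^+ 2 / 8 <=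
  \sum_i Num.max (l 0 i) (m 0 i) `^ (q - 2) * (l 0 i - m 0 i) ^+ 2.
Proof.
move=> [l0 l1] [m0 m1]; set A := \sum_i _.
have A0 : 0 <= A by apply: sumr_ge0 => i _; rewrite mulr_ge0 ?powR_ge0 ?sqr_ge0//.
set nu := lpnorm q (l - m).
have nu0 : 0 <= nu by exact: lpnorm_ge0.
move: nu0; rewrite le_eqVlt => /orP[/eqP<-|nu0].
  by rewrite expr0n /= mul0r.
(* For this eta the small coordinates account for at most half of nu^q. *)
pose eta := nu * (4 `^ q^-1)^-1.
have p4 : 0 < (4 : R) `^ q^-1 by rewrite powR_gt0.
have eta0 : 0 < eta by rewrite mulr_gt0// invr_gt0.
have etaq : eta `^ q = nu `^ q / 4.
  rewrite /eta powRM ?invr_ge0 ?(ltW p4)// ?(ltW nu0)//; congr (_ * _).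
  by rewrite -powRN -powRrM mulNr mulVf ?gt_eqF// powR_inv1.
have term i : `|(l - m) 0 i| `^ q <=
    eta `^ (q - 2) * (Num.max (l 0 i) (m 0 i) `^ (q - 2) * (l 0 i - m 0 i) ^+ 2)
      + eta `^ q * (l 0 i + m 0 i).
  have -> : (l - m) 0 i = l 0 i - m 0 i by rewrite !mxE.
  set w := Num.max _ _; set h := l 0 i - m 0 i.
  have w0 : 0 <= w by rewrite /w le_max l0.
  have w1 : w <= 1.
    rewrite /w ge_max; apply/andP; split.
      by apply: le_trans l1; rewrite (bigD1 i)//= lerDl sumr_ge0.
    by apply: le_trans m1; rewrite (bigD1 i)//= lerDl sumr_ge0.
  have wD : w <= l 0 i + m 0 i by rewrite /w ge_max lerDl lerDr l0 m0.
  have [le|lt] := leP `|h| (eta * w).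
    apply: (@le_trans _ _ (eta `^ q * (l 0 i + m 0 i))); last first.
      rewrite lerDr; apply: mulr_ge0; first exact: powR_ge0.
      by apply: mulr_ge0; [exact: powR_ge0 | exact: sqr_ge0].
    apply: (@le_trans _ _ ((eta * w) `^ q)).
      apply: ge0_ler_powR; [exact: ltW | exact: normr_ge0 | | exact: le].
      by apply: mulr_ge0 => //; exact: ltW.
    rewrite powRM ?(ltW eta0)//; apply: ler_wpM2l; first exact: powR_ge0.
    apply: le_trans wD; move: w0; rewrite le_eqVlt => /orP[/eqP<-|w0].
      by rewrite powR0// gt_eqF.
    by apply: ge1r_powR; [rewrite w0 w1 | exact: ltW].
  have h0 : 0 < `|h| by apply: le_lt_trans lt; rewrite mulr_ge0// ltW.
  have wpos : 0 < w.
    rewrite lt_neqAle w0 andbT eq_sym; apply/eqP => we.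
    have hl : l 0 i <= 0 by rewrite -we /w le_max lexx.
    have hm : m 0 i <= 0 by rewrite -we /w le_max lexx orbT.
    have hl0 : l 0 i = 0 by apply/eqP; rewrite eq_le hl l0.
    have hm0 : m 0 i = 0 by apply/eqP; rewrite eq_le hm m0.
    by move: h0; rewrite /h hl0 hm0 subrr normr0 ltxx.
  apply: (@le_trans _ _ (eta `^ (q - 2) * (w `^ (q - 2) * h ^+ 2))); last first.
    by rewrite lerDl mulr_ge0 ?powR_ge0// addr_ge0.
  have -> : `|h| `^ q = `|h| `^ (q - 2) * h ^+ 2.
    rewrite -real_normK ?num_real// -[`|h| ^+ 2]powR_mulrn// -powRD ?subrK//.
    by rewrite (gt_eqF h0) implybT.
  rewrite mulrA -powRM ?(ltW eta0)//; apply: ler_wpM2r; first exact: sqr_ge0.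
  have -> : q - 2 = - (2 - q) by ring.
  rewrite !powRN lef_pV2 ?posrE ?powR_gt0 ?mulr_gt0//.
  apply: ge0_ler_powR; rewrite ?nnegrE ?subr_ge0//; last exact: ltW.
  by rewrite mulr_ge0// ltW.
have sumle : nu `^ q <= eta `^ (q - 2) * A + nu `^ q / 2.
  rewrite /nu lpnorm_powR// -/nu.
  apply: le_trans (ler_sum _ (fun i _ => term i)) _.
  rewrite big_split -!mulr_sumr lerD2l etaq big_split /=.
  have -> : nu `^ q = powsum q (l - m) by rewrite /nu lpnorm_powR.
  have S0 := powsum_ge0 q (l - m).
  move: (powsum _ _) (\sum_i l 0 i) (\sum_i m 0 i) S0 l1 m1 => S X Y; nra.
have e1 : nu `^ q = nu `^ (q - 2) * nu ^+ 2.
  rewrite -powR_mulrn ?(ltW nu0)// -powRD ?subrK//.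
  by rewrite (gt_eqF q0) ?implybT.
have e2 : eta `^ (q - 2) <= nu `^ (q - 2) * 4.
  rewrite /eta powRM ?(ltW nu0) ?invr_ge0 ?(ltW p4)//; apply: ler_wpM2l; first exact: powR_ge0.
  rewrite -powRN -powRrM.
  have h41 : 1 <= 4 :> R by rewrite ler1n.
  apply: (@le_trans _ _ (4 `^ 1)); last by rewrite powRr1.
  apply: ler_powR => //.
  rewrite mulNr -mulrN opprB mulrC ler_pdivrMr// mul1r; have := q1; lra.
have n2 : 0 < nu `^ (q - 2) by rewrite powR_gt0.
have : nu `^ (q - 2) * (nu ^+ 2 / 2) <= nu `^ (q - 2) * (4 * A).
  apply: (@le_trans _ _ (eta `^ (q - 2) * A)).
    by move: sumle; rewrite e1; lra.
  by rewrite mulrA ler_wpM2r.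
rewrite ler_pM2l//; lra.
Qed.

(** The sum of the variational inequalities of the two maximizers. *)
Lemma smax_arg_monotone y z :
  c * (q - 1) * (lpnorm q (arg y - arg z) ^+ 2 / 8) <= dotr (y - z) (arg y - arg z).
Proof.
set l := arg y; set m := arg z.
have ls : simplex l := smax_arg_simplex c s2 y.
have ms : simplex m := smax_arg_simplex c s2 z.
have h1 := smax_arg_variational s2 c0 y ms; have h2 := smax_arg_variational s2 c0 z ls.
rewrite -/l -/m -/q in h1 h2.
have cq0 : 0 <= c * q by rewrite mulr_ge0// ltW.
have h3 : c * q * \sum_i ((l 0 i) `^ (q - 1) - (m 0 i) `^ (q - 1)) * (l 0 i - m 0 i)
    <= dotr (y - z) (l - m).
  have -> : \sum_i ((l 0 i) `^ (q - 1) - (m 0 i) `^ (q - 1)) * (l 0 i - m 0 i) =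
    - (\sum_i (m - l) 0 i * l 0 i `^ (q - 1) + \sum_i (l - m) 0 i * m 0 i `^ (q - 1)).
    rewrite -big_split -sumrN; apply: eq_bigr => i _; rewrite !mxE /=; ring.
  have -> : dotr (y - z) (l - m) = - (dotr (m - l) y + dotr (l - m) z).
    by rewrite dotrBl -(opprB l m) (dotrC (- _)) dotrNr (dotrC _ z); ring.
  by rewrite mulrN lerN2 mulrDr lerD.
apply: le_trans h3.
have h4 := simplex_strong_monotone ls ms; rewrite -/l -/m in h4.
have q10 : 0 <= q - 1 by rewrite subr_ge0 ltW.
apply: (@le_trans _ _ (c * (q - 1) * \sum_i Num.max (l 0 i) (m 0 i) `^ (q - 2) * (l 0 i - m 0 i) ^+ 2)).
  by apply: ler_wpM2l => //; rewrite mulr_ge0// ltW.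
apply: (@le_trans _ _ (c * q * ((q - 1) * \sum_i Num.max (l 0 i) (m 0 i) `^ (q - 2) * (l 0 i - m 0 i) ^+ 2))).
  rewrite -[c * q * _]mulrA -[c * (q - 1) * _]mulrA; apply: ler_wpM2l; first exact: ltW.
  rewrite ler_peMl ?(ltW q1)// mulr_ge0// sumr_ge0// => i _.
  by rewrite mulr_ge0 ?powR_ge0 ?sqr_ge0//.
apply: ler_wpM2l => //; rewrite mulr_sumr; apply: ler_sum => i _.
apply: powR_sub_monotone; [by case: ls | by case: ms].
Qed.

Lemma smax_arg_lip y z : lpnorm q (arg y - arg z) <= 8 * (s - 1) / c * lpnorm s (y - z).
Proof.
have h := smax_arg_monotone y z.
have h2 := dotr_le (arg y - arg z) (y - z) s1; rewrite dotrC in h2.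
have := le_trans h h2; rewrite -/q; set nu := lpnorm q _.
have nu0 : 0 <= nu by exact: lpnorm_ge0.
have k0 : 0 <= 8 * (s - 1) / c.
  by rewrite divr_ge0 ?(ltW c0)// mulr_ge0// subr_ge0 ltW.
move: nu0; rewrite le_eqVlt => /orP[/eqP<- _|nu0].
  by rewrite mulr_ge0// lpnorm_ge0.
have -> : q - 1 = (s - 1)^-1 by exact: conj_exp_sub1.
have -> : c / (s - 1) * (nu ^+ 2 / 8) = nu * (nu / (8 * (s - 1) / c)).
  by rewrite expr2; field; rewrite !gt_eqF// subr_gt0.
rewrite ler_pM2l// ler_pdivrMr; first by rewrite mulrC.
by rewrite divr_gt0// mulr_gt0// subr_gt0.
Qed.

Lemma smax_subgradient y z : smax s c y + dotr (arg y) (z - y) <= smax s c z.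
Proof.
have [_ h] := smax_argP c s2 z; apply: le_trans (h _ (smax_arg_simplex c s2 y)).
by rewrite /smax /penalized dotrBr; lra.
Qed.

(** Each maximizer gives a linear lower bound at the other point, and the
    slopes differ by a Lipschitz amount. *)
Lemma smax_quadratic y z :
  `|smax s c z - smax s c y - dotr (arg y) (z - y)| <= 8 * (s - 1) / c * lpnorm s (z - y) ^+ 2.
Proof.
have aux0 (Y Z D : R) : Y + D <= Z -> 0 <= Z - Y - D by lra.
have aux (Y Z D E : R) : Z - E <= Y -> Z - Y - D <= E - D by lra.
have h1 := smax_subgradient y z; have h2 := smax_subgradient z y.
rewrite ger0_norm; last exact: aux0.
have h3 : dotr (arg z - arg y) (z - y) <= 8 * (s - 1) / c * lpnorm s (z - y) ^+ 2.
  apply: le_trans (dotr_le _ _ s1) _; rewrite expr2 mulrA.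
  by apply: ler_wpM2r; [exact: lpnorm_ge0 | exact: smax_arg_lip].
apply: le_trans h3; rewrite (dotrBl (z - y) (arg z) (arg y)).
by apply: aux; rewrite -dotrNr opprB.
Qed.

Lemma smax_convex (t : R) y z : 0 <= t <= 1 ->
  smax s c (t *: y + (1 - t) *: z) <= t * smax s c y + (1 - t) * smax s c z.
Proof.
move=> /andP[t0 t1]; set l := arg (t *: y + (1 - t) *: z).
have ls : simplex l := smax_arg_simplex c s2 _.
have [_ /(_ _ ls) hy] := smax_argP c s2 y; have [_ /(_ _ ls) hz] := smax_argP c s2 z.
have t1' : 0 <= 1 - t by rewrite subr_ge0.
have := lerD (ler_wpM2l t0 hy) (ler_wpM2l t1' hz); apply: le_trans.
by rewrite /smax /penalized -/l dotrDr !dotrZr; lra.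
Qed.

Lemma smax_ge0 y : 0 <= smax s c y.
Proof.
have [_ /(_ _ (@simplex0 R d))] := smax_argP c s2 y; apply: le_trans.
by rewrite /penalized dot0r powsum0// mulr0 subrr.
Qed.

(** A small mass e on a positive coordinate gains a multiple of e, and the
    penalty c e^q is of higher order. *)
Lemma smax_le0P y : (smax s c y <= 0) <-> (forall i, y 0 i <= 0).
Proof.
split=> [h i|h]; last first.
  rewrite /smax /penalized; set l := arg y.
  have [l0 _] : simplex l := smax_arg_simplex c s2 y.
  rewrite subr_le0; apply: (@le_trans _ _ 0).
    by apply: sumr_le0 => i _; rewrite mulr_ge0_le0.
  by apply: mulr_ge0; [exact: ltW | exact: powsum_ge0].
rewrite leNgt; apply/negP => yi.
have r0 : 0 < q - 1 by rewrite subr_gt0.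
(* Small enough for the penalty to eat at most half of the gain. *)
pose e := Num.min 1 ((y 0 i / (2 * c)) `^ (q - 1)^-1).
have e0 : 0 < e by rewrite lt_min ltr01 powR_gt0// divr_gt0// mulr_gt0.
have er : c * e `^ (q - 1) <= y 0 i / 2.
  have : e `^ (q - 1) <= y 0 i / (2 * c).
    rewrite -[leRHS](@powRVK R _ (q - 1)) ?gt_eqF//; last by rewrite divr_ge0 ?mulr_ge0 ?ltW.
    apply: ge0_ler_powR; rewrite ?nnegrE ?powR_ge0 ?(ltW e0) ?(ltW r0)//.
    by rewrite /e ge_min lexx orbT.
  move=> /(ler_wpM2l (ltW c0)) /le_trans; apply.
  by rewrite le_eqVlt; apply/orP; left; apply/eqP; field; rewrite gt_eqF.
pose l : 'rV[R]_d := e *: delta_mx 0 i.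
have lE k : l 0 k = e * (k == i)%:R by rewrite !mxE eqxx.
have ls : simplex l.
  split => [k|]; first by rewrite lE mulr_ge0// ltW.
  under eq_bigr do rewrite lE.
  rewrite -mulr_sumr (bigD1 i)//= eqxx big1 => [|k /negbTE -> //].
  by rewrite addr0 mulr1 /e ge_min lexx.
have [_ /(_ _ ls) hv] := smax_argP c s2 y.
have pe : powsum q l = e `^ q.
  rewrite /powsum (bigD1 i)//= big1 ?addr0 => [|k /negbTE ki].
    by rewrite lE eqxx mulr1 ger0_norm// ltW.
  by rewrite lE ki mulr0 normr0 powR0 ?gt_eqF.
have de : dotr l y = e * y 0 i.
  rewrite /dotr (bigD1 i)//= big1 ?addr0 => [|k /negbTE ki].
    by rewrite lE eqxx mulr1.
  by rewrite lE ki mulr0 mul0r.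
have := le_trans hv h; rewrite /penalized -/q pe de -(mulr_powRB1 (ltW e0) q0).
have -> : e * y 0 i - c * (e * e `^ (q - 1)) = e * (y 0 i - c * e `^ (q - 1)) by ring.
by rewrite pmulr_rle0//; lra.
Qed.

(** By monotonicity the maximizers can only differ through the coordinates
    where y and z differ, and there both vanish. *)
Lemma smax_invisible y z (j : 'I_d) : (forall i, i != j -> y 0 i = z 0 i) ->
  arg y 0 j = 0 -> arg z 0 j = 0 -> arg y = arg z /\ smax s c y = smax s c z.
Proof.
move=> yz yj zj.
have e : arg y = arg z.
  have : dotr (y - z) (arg y - arg z) = 0.
    rewrite /dotr big1// => i _; have [->|ij] := eqVneq i j.
      by rewrite !mxE yj zj subrr mulr0.
    by rewrite !mxE yz// subrr mul0r.
  have := smax_arg_monotone y z => /[swap] ->.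
  have k0 : 0 < c * (q - 1) by rewrite mulr_gt0// subr_gt0.
  rewrite pmulr_rle0// => h.
  have : lpnorm q (arg y - arg z) = 0.
    apply/eqP; rewrite -[_ == 0](@expf_eq0 _ _ 2) eq_le sqr_ge0 andbT; lra.
  by move=> /(lpnorm_eq0 q0)/eqP; rewrite subr_eq0 => /eqP.
have dE : dotr (arg y) y = dotr (arg y) z.
  apply: eq_bigr => i _; have [->|ij] := eqVneq i j; first by rewrite yj !mul0r.
  by rewrite (yz _ ij).
by split; [exact: e | rewrite /smax /penalized -e dE].
Qed.

End smoothed_maximum_regularity.

(** * The hard functions *)

Section hard_function.
Variables (R : realType) (d : nat) (s c kap p L : R) (x0 xi h : 'rV[R]_d).
Hypotheses (s2 : 2 <= s) (c0 : 0 < c) (kap0 : 0 < kap) (p2 : 2 < p).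
Hypotheses (sp : forall u : 'rV[R]_d, lpnorm s u <= 4 * lpnorm p u).
Hypotheses (xi1 : forall j, `|xi 0 j| <= 1).
Hypotheses (h0 : forall j, 0 <= h 0 j) (xih : forall j, xi 0 j * (xi 0 j * h 0 j) = h 0 j).
Implicit Types (x y z u v : 'rV[R]_d).

Let s1 : 1 < s. Proof. by apply: lt_le_trans s2; rewrite ltr1n. Qed.
Let s0 : 0 < s. Proof. exact: lt_trans s1. Qed.
Let p1 : 1 < p. Proof. by apply: lt_trans p2; rewrite ltr1n. Qed.
Let p0 : 0 < p. Proof. exact: lt_trans p1. Qed.

Definition signed x : 'rV[R]_d := \row_j (xi 0 j * x 0 j).
(** The signed coordinates of x - x0, shifted by h: the arguments of the
    maximum. *)
Definition activation x : 'rV[R]_d := signed (x - x0) + h.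
Definition hard_function x : R := kap * smax s c (activation x).
Definition hard_gradient x : 'rV[R]_d := kap *: signed (smax_arg s c (activation x)).

Lemma signedB x y : signed (x - y) = signed x - signed y.
Proof. by apply/rowP => j; rewrite !mxE; ring. Qed.

Lemma activationB x y : activation x - activation y = signed (x - y).
Proof. by apply/rowP => j; rewrite !mxE; ring. Qed.

Lemma dotr_signed u v : dotr (signed u) v = dotr u (signed v).
Proof. by apply: eq_bigr => j _; rewrite !mxE; ring. Qed.

Lemma lpnorm_signed (r : R) u : 0 < r -> lpnorm r (signed u) <= lpnorm r u.
Proof.
move=> r0; apply: ler_lpnorm => //; apply: ler_sum => j _.
apply: ge0_ler_powR; rewrite ?nnegrE// ?(ltW r0)//.
by rewrite mxE normrM ler_piMl.
Qed.

Lemma hard_differentiable x : differentiable hard_function x /\ gradient hard_function x = hard_gradient x.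
Proof.
pose K := kap * (8 * (s - 1) / c) * (d%:R `^ s^-1) ^+ 2.
apply: (@quadratic_differentiable _ _ _ _ _ K) => v.
have e : activation (v + x) - activation x = signed v by rewrite activationB addrK.
have k0 : 0 <= 8 * (s - 1) / c by rewrite divr_ge0 ?mulr_ge0 ?subr_ge0 ?(ltW s1) ?(ltW c0).
have := smax_quadratic s2 c0 (activation x) (activation (v + x)); rewrite e.
have -> : hard_function (v + x) - hard_function x - dotr (hard_gradient x) v = kap *
   (smax s c (activation (v + x)) - smax s c (activation x) - dotr (smax_arg s c (activation x)) (signed v)).
  rewrite /hard_gradient dotrZl dotr_signed /hard_function.
  by move: (smax _ _ _) (smax _ _ _) (dotr _ _) => X Y Z; ring.
have -> : K * `|v| ^+ 2 = kap * (8 * (s - 1) / c * (d%:R `^ s^-1 * `|v|) ^+ 2).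
  by rewrite /K exprMn !mulrA.
move=> hq; rewrite normrM (gtr0_norm kap0); apply: ler_wpM2l; first exact: ltW.
apply: le_trans hq _.
apply: ler_wpM2l => //; rewrite lerXn2r ?nnegrE ?lpnorm_ge0 ?mulr_ge0 ?powR_ge0//.
apply: le_trans (lpnorm_signed _ s0) _; apply: lpnorm_le_sup => // i.
exact: coord_le_mxnorm.
Qed.

Lemma gradient_hard x : gradient hard_function x = hard_gradient x.
Proof. by case: (hard_differentiable x). Qed.

Lemma hard_convexf : convexf hard_function.
Proof.
have aux (k Z t X Y : R) : 0 <= k -> Z <= t * X + (1 - t) * Y ->
    k * Z <= t * (k * X) + (1 - t) * (k * Y).
  by move=> k0 /(ler_wpM2l k0); lra.
move=> t x y t01.
have e : activation (t *: x + (1 - t) *: y) = t *: activation x + (1 - t) *: activation y.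
  by apply/rowP => j; rewrite !mxE; ring.
rewrite /hard_function e; apply: aux; first exact: ltW.
exact: smax_convex.
Qed.

(** The dual of the comparison between the l_s and the l_p norms. *)
Lemma conjugate_norm_le u :
  lpnorm (conjugate_exponent p) u <= 4 * lpnorm (conjugate_exponent s) u.
Proof.
apply: lpnorm_dual => //; first by rewrite mulr_ge0// lpnorm_ge0.
move=> v; apply: le_trans (dotr_le _ _ s1) _.
by rewrite mulrAC mulrC ler_wpM2r// lpnorm_ge0.
Qed.

Definition hard_minimizer : 'rV[R]_d := x0 - signed h.

Lemma hard_minimizerP : argmin hard_function hard_minimizer.
Proof.
move=> y; apply: (@le_trans _ _ 0); last by rewrite mulr_ge0 ?(ltW kap0)// (smax_ge0 c s2).
rewrite pmulr_rle0//; apply/(smax_le0P s2 c0) => i.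
by rewrite !mxE addrAC subrr sub0r mulrN xih addrC subrr.
Qed.

Lemma hard_admissible : 128 * kap * (s - 1) / c <= L -> admissible p L hard_function.
Proof.
move=> hL; split.
- by move=> x; case: (hard_differentiable x).
- exact/convex_functionP/hard_convexf.
- by exists hard_minimizer; exact: hard_minimizerP.
move=> x y; rewrite !gradient_hard /hard_gradient -scalerBr -signedB.
have q0 : 0 < conjugate_exponent s by apply: lt_trans (conj_exp_gt1 s1).
have k0 : 0 <= 8 * (s - 1) / c by rewrite divr_ge0 ?mulr_ge0 ?subr_ge0 ?(ltW s1) ?(ltW c0).
apply: le_trans (conjugate_norm_le _) _; rewrite lpnormZ// (gtr0_norm kap0).
apply: (@le_trans _ _ (4 * (kap * (8 * (s - 1) / c * (4 * lpnorm p (x - y)))))).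
  apply: ler_wpM2l => //; apply: ler_wpM2l; first exact: ltW.
  apply: le_trans (lpnorm_signed _ q0) _.
  apply: le_trans (smax_arg_lip s2 c0 _ _) _.
  apply: ler_wpM2l => //; rewrite activationB.
  exact: le_trans (lpnorm_signed _ s0) (sp _).
have -> : 4 * (kap * (8 * (s - 1) / c * (4 * lpnorm p (x - y)))) =
  128 * kap * (s - 1) / c * lpnorm p (x - y) by ring.
by apply: ler_wpM2r => //; exact: lpnorm_ge0.
Qed.

(** The minimizers are the points with nonpositive activation, which forces
    |(x - x0)_i| >= h_i; the corner where all these are equalities realizes
    the distance. *)
Lemma hard_lpdist : lpdist p x0 (argmin hard_function) = lpnorm p h.
Proof.
have att : [set lpnorm p (x0 - y) | y in argmin hard_function] (lpnorm p h).
  exists hard_minimizer; first exact: hard_minimizerP.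
  rewrite /hard_minimizer opprB addrC subrK; congr (_ `^ _).
  apply: eq_bigr => i _; rewrite mxE normrM; congr (_ `^ _).
  have [->|hi] := eqVneq (h 0 i) 0; first by rewrite normr0 mulr0.
  have /(congr1 Num.norm) := xih i; rewrite mulrA !normrM -[RHS]mul1r.
  move=> /(mulIf _) -/(_ _)/eqP; rewrite normr_eq0 => /(_ hi).
  rewrite -expr2 sqrf_eq1 => /orP[/eqP->|/eqP e]; first by rewrite mul1r.
  by have := normr_ge0 (xi 0 i); rewrite e; lra.
have lb : lbound [set lpnorm p (x0 - y) | y in argmin hard_function] (lpnorm p h).
  move=> _ [y ym <-]; apply: ler_lpnorm => //; apply: ler_sum => i _.
  apply: ge0_ler_powR; rewrite ?nnegrE// ?(ltW p0)//.
  have le0 : smax s c (activation y) <= 0.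
    have := ym hard_minimizer; rewrite -(pmulr_rle0 _ kap0) => /le_trans; apply.
    rewrite pmulr_rle0//; apply/(smax_le0P s2 c0) => j.
    by rewrite !mxE addrAC subrr sub0r mulrN xih addrC subrr.
  have := (smax_le0P s2 c0 _).1 le0 i; rewrite !mxE => hi.
  rewrite (ger0_norm (h0 i)).
  have hle : h 0 i <= - (xi 0 i * (y 0 i - x0 0 i)) by rewrite -sub0r lerBrDl.
  apply: le_trans hle _; apply: le_trans (ler_norm _) _.
  by rewrite normrN normrM distrC ler_piMl.
apply/eqP; rewrite eq_le; apply/andP; split.
  by apply: ge_inf => //; exists (lpnorm p h).
by apply: lb_le_inf => //; exists (lpnorm p h).
Qed.

End hard_function.

(** * The resisting adversary *)

Section query_prefixes.
Variables (R : realType) (d : nat) (x0 : 'rV[R]_d) (A : algorithm x0).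
Implicit Types (f g : 'rV[R]_d -> R).

Lemma queries_prefix f n x : x \in queries A f n -> x \in queries A f n.+1.
Proof. by move=> xn /=; case: (step _ _) => // y; rewrite mem_rcons inE xn orbT. Qed.

Lemma queries_sub f m n x : (m <= n)%N -> x \in queries A f m -> x \in queries A f n.
Proof.
move=> /subnK <-; elim: (n - m)%N => [//|k IH] /IH; exact: queries_prefix.
Qed.

(** A query only depends on the answers before it, so the adversary may choose
    a coordinate in view of the query that it answers. *)
Lemma queries_eq f g n : (forall x, x \in queries A f n -> oracle f x = oracle g x) ->
  queries A g n.+1 = queries A f n.+1.
Proof.
elim: n => [//|n IH] fg.
have e : queries A g n.+1 = queries A f n.+1.
  by apply: IH => x xn; apply: fg; exact: queries_prefix.
rewrite -[queries A g n.+2]/(match A (map (oracle g) (queries A g n.+1)) with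
  inl x => rcons (queries A g n.+1) x | inr _ => queries A g n.+1 end).
rewrite e.
have -> : map (oracle g) (queries A f n.+1) = map (oracle f) (queries A f n.+1).
  by apply/eq_in_map => x xn; rewrite fg.
by [].
Qed.

Lemma queries_active f n x : A (map (oracle f) (queries A f n)) = inl x ->
  size (queries A f n) = n.
Proof.
elim: n x => [//|n IH] x /=; case E : (step A _) => [y|i].
  by move=> _; rewrite size_rcons (IH _ E).
by rewrite E.
Qed.

End query_prefixes.

Section adversary.
Variables (R : realType) (d T : nat) (s c kap del : R) (x0 : 'rV[R]_d).
Hypotheses (s2 : 2 <= s) (c0 : 0 < c) (kap0 : 0 < kap) (cdel : c * conjugate_exponent s < del).
Implicit Types (x y : 'rV[R]_d) (pi : seq ('I_d * bool)).

(** A pattern lists the coordinates revealed so far, with their signs (true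
    for the negative one); the others have sign and shift 0. *)
Definition pattern_sign pi : 'rV[R]_d := \row_j
  (if j \in unzip1 pi then (-1) ^+ nth false (unzip2 pi) (index j (unzip1 pi)) else 0).

(** The shifts T del, (T-1) del, ... decrease along the list, to hide the
    coordinates revealed later. *)
Definition pattern_shift pi : 'rV[R]_d := \row_j
  (if j \in unzip1 pi then (T - index j (unzip1 pi))%:R * del else 0).

Definition pattern_function pi : 'rV[R]_d -> R :=
  hard_function s c kap x0 (pattern_sign pi) (pattern_shift pi).

(** At x the n-th revealed coordinate dominates all those revealed later or
    not at all; the latter have index size pi, so that one inequality between
    indices speaks of both. *)
Definition covers pi n x := (n < size pi)%N /\
  forall j, index j (unzip1 pi) = n ->
    pattern_sign pi 0 j * (x - x0) 0 j = `|(x - x0) 0 j| /\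
    forall k, (n < index k (unzip1 pi))%N -> `|(x - x0) 0 k| <= `|(x - x0) 0 j|.

Lemma pattern_sign_le1 pi j : `|pattern_sign pi 0 j| <= 1.
Proof. by rewrite mxE; case: ifP => _; rewrite ?normr0// normrX normrN1 expr1n. Qed.

Lemma del_gt0 : 0 < del.
Proof.
apply: le_lt_trans cdel; rewrite mulr_ge0 ?(ltW c0)//.
by apply: ltW; apply: lt_trans (conj_exp_gt1 _); rewrite ?ltr01//; apply: lt_le_trans s2; rewrite ltr1n.
Qed.

Section extension.
Variables (pi : seq ('I_d * bool)) (j : 'I_d) (b : bool).
Hypotheses (jpi : j \notin unzip1 pi) (piT : (size pi < T)%N).
Let pi' := rcons pi (j, b).

Lemma index_extend k : index k (unzip1 pi') =
  if k \in unzip1 pi then index k (unzip1 pi) else (size pi + (k != j))%N.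
Proof.
rewrite /pi' /unzip1 map_rcons -cats1 index_cat; case: ifP => // _.
by rewrite size_map /= eq_sym; case: eqP.
Qed.

Lemma mem_extend k : (k \in unzip1 pi') = (k == j) || (k \in unzip1 pi).
Proof. by rewrite /pi' /unzip1 map_rcons mem_rcons inE. Qed.

Lemma nth_extend n : (n < size pi)%N -> nth false (unzip2 pi') n = nth false (unzip2 pi) n.
Proof. by move=> np; rewrite /pi' /unzip2 map_rcons nth_rcons size_map np. Qed.

Lemma index_lt_size k : k \in unzip1 pi -> (index k (unzip1 pi) < size pi)%N.
Proof. by rewrite -index_mem size_map. Qed.

Lemma sign_extend k : k != j -> pattern_sign pi' 0 k = pattern_sign pi 0 k.
Proof.
move=> /negbTE kj; rewrite !mxE mem_extend kj /= index_extend; case: ifP => // kpi.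
by rewrite kpi nth_extend; last exact: index_lt_size.
Qed.

Lemma shift_extend k : k != j -> pattern_shift pi' 0 k = pattern_shift pi 0 k.
Proof.
by move=> /negbTE kj; rewrite !mxE mem_extend kj /= index_extend; case: ifP => // kpi; rewrite kpi.
Qed.

Lemma covers_extend n x : covers pi n x -> covers pi' n x.
Proof.
move=> [np h]; split; first by rewrite size_rcons ltnS ltnW.
move=> k; rewrite index_extend; case: ifP => [kpi kn|_ kn]; last first.
  by move: np; rewrite -kn -ltn_subRL subnn ltn0.
have kj : k != j by apply: contraTneq kpi => ->.
have [h1 h2] := h k kn; rewrite sign_extend//; split => // l hl; apply: h2.
have [lpi|lpi] := boolP (l \in unzip1 pi).
  by move: hl; rewrite index_extend lpi.
by rewrite (memNindex lpi) size_map.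
Qed.

Lemma activation_extend x k : k != j ->
  activation x0 (pattern_sign pi) (pattern_shift pi) x 0 k =
  activation x0 (pattern_sign pi') (pattern_shift pi') x 0 k.
Proof.
move=> kj.
have aE w v l : activation x0 w v x 0 l = w 0 l * (x - x0) 0 l + v 0 l by rewrite !mxE.
by rewrite !aE sign_extend// shift_extend.
Qed.

(** At x the coordinate of index n exceeds the new one by at least del, before
    and after it is revealed, so the new coordinate has weight 0 in both
    maxima. *)
Lemma covers_oracle n x : uniq (unzip1 pi) -> covers pi n x ->
  oracle (pattern_function pi) x = oracle (pattern_function pi') x.
Proof.
move=> upi [np h].
have d0 := ltW del_gt0.
have nu : (n < size (unzip1 pi))%N by rewrite size_map.
pose i := nth j (unzip1 pi) n.
have iin : i \in unzip1 pi by exact: mem_nth.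
have ix : index i (unzip1 pi) = n by exact: index_uniq.
have ij : i != j by apply: contraTneq iin => ->.
have [h1 h2] := h i ix.
have aE w v l : activation x0 w v x 0 l = w 0 l * (x - x0) 0 l + v 0 l by rewrite !mxE.
set y := activation x0 (pattern_sign pi) (pattern_shift pi) x.
set z := activation x0 (pattern_sign pi') (pattern_shift pi') x.
have yi : y 0 i = `|(x - x0) 0 i| + (T - n)%:R * del.
  by rewrite /y aE h1; congr (_ + _); rewrite mxE iin ix.
have zi : z 0 i = `|(x - x0) 0 i| + (T - n)%:R * del by rewrite -activation_extend.
have yj : y 0 j = 0 by rewrite /y aE !mxE (negbTE jpi) mul0r addr0.
have jn : (n < index j (unzip1 pi))%N by rewrite (memNindex jpi).
have zj : z 0 j <= `|(x - x0) 0 i| + (T - size pi)%:R * del.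
  rewrite /z aE; apply: lerD.
    apply: le_trans (ler_norm _) _; rewrite normrM; apply: le_trans (h2 j jn).
    by apply: ler_piMl => //; exact: pattern_sign_le1.
  by rewrite mxE mem_extend eqxx /= index_extend (negbTE jpi) eqxx addn0.
have gap1 : del <= (T - n)%:R * del - (T - size pi)%:R * del.
  have -> : (T - n = (T - size pi) + (size pi - n))%N by move: np piT; clear; lia.
  rewrite natrD mulrDl addrAC subrr add0r; apply: ler_peMl => //.
  by rewrite ler1n subn_gt0.
have gap2 : del <= (T - n)%:R * del.
  by apply: ler_peMl => //; rewrite ler1n subn_gt0; exact: ltn_trans np piT.
have ay : smax_arg s c y 0 j = 0.
  apply: (smax_arg_eq0 s2 c0 (i := i)); apply: lt_le_trans cdel _.
  by rewrite yi yj subr0; apply: le_trans gap2 _; rewrite lerDr.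
have az : smax_arg s c z 0 j = 0.
  apply: (smax_arg_eq0 s2 c0 (i := i)); apply: lt_le_trans cdel _.
  by rewrite zi; apply: le_trans gap1 _; move: zj; lra.
have yz k : k != j -> y 0 k = z 0 k by exact: activation_extend.
have gE w : gradient (pattern_function w) x =
    hard_gradient s c kap x0 (pattern_sign w) (pattern_shift w) x.
  exact: (gradient_hard x0 (pattern_shift w) s2 c0 kap0 (pattern_sign_le1 w)).
have yE : oracle (pattern_function pi) x =
    (kap * smax s c y, kap *: signed (pattern_sign pi) (smax_arg s c y)).
  by rewrite /oracle gE.
have zE : oracle (pattern_function pi') x =
    (kap * smax s c z, kap *: signed (pattern_sign pi') (smax_arg s c z)).
  by rewrite /oracle gE.
apply: (eq_trans yE (eq_trans _ (esym zE))); move: ay az yz.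
move: y z {yi zi yj zj yE zE} => y z ay az yz.
have [ea es] := smax_invisible s2 c0 yz ay az.
rewrite -ea -es.
have -> : signed (pattern_sign pi) (smax_arg s c y) = signed (pattern_sign pi') (smax_arg s c y) => //.
apply/rowP => k; rewrite mxE [RHS]mxE.
have [->|kj] := eqVneq k j; first by rewrite ay !mulr0.
by rewrite sign_extend.
Qed.

End extension.

(** The adversary's choice: the unrevealed coordinate where x is farthest from
    x0, with the sign that makes its activation large. *)
Lemma extend_pattern pi (x : 'rV[R]_d) : (size pi < d)%N -> uniq (unzip1 pi) ->
  exists j b, [/\ j \notin unzip1 pi & covers (rcons pi (j, b)) (size pi) x].
Proof.
move=> sz upi.
have [k kpi] : exists k, k \notin unzip1 pi.
  apply/existsP; rewrite -negb_forall; apply/negP => /forallP al.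
  have : (#|'I_d| <= size (unzip1 pi))%N.
    rewrite -(card_uniqP upi); apply: eq_leq; apply: eq_card => k.
    by rewrite al.
  by rewrite card_ord size_map leqNgt sz.
pose P k := k \notin unzip1 pi.
case: (@arg_maxP _ _ _ k P (fun k => `|(x - x0) 0 k|) kpi) => j jP jmax.
exists j, ((x - x0) 0 j < 0); split => //; split; first by rewrite size_rcons.
move=> l; rewrite index_extend; case: ifP => [lpi|lpi].
  by move: (index_lt_size lpi) => /[swap] ->; rewrite ltnn.
have [-> _|lj] := eqVneq l j; last by rewrite /= addn1 => /eqP; rewrite eqn_leq ltnn.
split.
  rewrite mxE mem_extend eqxx /= index_extend (negbTE jP) eqxx addn0.
  rewrite /unzip2 map_rcons nth_rcons size_map ltnn eqxx /=.
  have [lt|ge] := ltrP ((x - x0) 0 j) 0; first by rewrite expr1 mulN1r ltr0_norm.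
  by rewrite expr0 mul1r ger0_norm.
move=> k'; rewrite index_extend; case: ifP => [k'pi|k'pi _].
  by move=> /ltn_trans/(_ (index_lt_size k'pi)); rewrite ltnn.
by apply: jmax; rewrite /P k'pi.
Qed.

(** The pattern already chosen determines the next query, which in turn
    selects the next coordinate; by [covers_oracle] the earlier answers remain
    valid. *)
Lemma adversary (A : algorithm x0) t : (t <= T)%N -> (T <= d)%N ->
  exists pi, [/\ size pi = t, uniq (unzip1 pi) &
    forall n, (n < size (queries A (pattern_function pi) t))%N ->
      covers pi n (nth 0 (queries A (pattern_function pi) t) n)].
Proof.
move=> tT Td; elim: t tT => [|t IH] tT; first by exists [::].
have [pi [sz upi hc]] := IH (ltnW tT).
set qs := queries A (pattern_function pi) t in hc.
pose x := if A (map (oracle (pattern_function pi)) qs) is inl x then x else x0.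
have szd : (size pi < d)%N by rewrite sz; exact: leq_trans tT Td.
have szT : (size pi < T)%N by rewrite sz.
have [j [b [jpi cx]]] := extend_pattern x szd upi.
set pi' := rcons pi (j, b) in cx.
have qE : queries A (pattern_function pi') t.+1 = queries A (pattern_function pi) t.+1.
  apply: queries_eq => y /(nthP 0)[n nq <-].
  exact: covers_oracle (hc n nq).
exists pi'; split; first by rewrite size_rcons sz.
  by rewrite /unzip1 map_rcons rcons_uniq jpi.
rewrite qE /= -/qs; move: cx; rewrite /x; case E : (step A _) => [w|w] cx n.
  rewrite size_rcons ltnS nth_rcons => nq.
  have szq : size qs = t by exact: queries_active E.
  case: ltnP => [nlt|nge]; first exact: (covers_extend b jpi (hc n nlt)).
  have -> : n = size qs by apply/eqP; rewrite eqn_leq nq nge.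
  by rewrite eqxx szq -sz.
by move=> nq; exact: (covers_extend b jpi (hc n nq)).
Qed.

End adversary.

(** * The lower bound *)

Section lower_bound.
Variable R : realType.

Lemma expR_half_le2 : expR (2^-1 : R) <= 2.
Proof.
have h := @expR_ge1Dx R (- 2^-1).
have e0 : 0 < expR (2^-1 : R) := expR_gt0 _.
move: h; rewrite expRN => h.
have : 2^-1 <= (expR (2^-1 : R))^-1 by apply: le_trans h; lra.
by rewrite lef_pV2 ?posrE.
Qed.

Lemma expR1_le4 : expR (1 : R) <= 4.
Proof.
rewrite [X in expR X](_ : 1 = 2^-1 + 2^-1); last by field.
rewrite expRD (_ : 4 = 2 * 2); last by ring.
by apply: ler_pM; rewrite ?expR_ge0// expR_half_le2.
Qed.

(** This is what allows ln d, rather than 1 + ln d, in the bounds down to d =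
    2. *)
Lemma ln_nat_ge_half (d : nat) : (2 <= d)%N -> 2^-1 <= ln (d%:R : R).
Proof.
move=> d2; rewrite -[leLHS]expRK ler_ln ?posrE ?expR_gt0 ?ltr0n ?(leq_trans _ d2)//.
by apply: le_trans expR_half_le2 _; rewrite ler_nat.
Qed.

(** The norms with exponent at least ln d are equivalent up to a constant: for
    larger p, smoothing with ln d in place of p keeps the smoothness constant
    of order ln d. *)
Definition hard_exponent (p : R) (d : nat) : R := Num.min p (Num.max 2 (ln d%:R)).

Lemma hard_exponent_ge2 p d : 2 < p -> 2 <= hard_exponent p d.
Proof. by move=> p2; rewrite le_min ltW//= le_max lexx. Qed.

Lemma hard_exponent_le p d : 2 < p -> (2 <= d)%N ->
  hard_exponent p d <= 4 * Num.min p (ln d%:R).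
Proof.
move=> p2 d2; have l2 := ln_nat_ge_half d2; set l := ln _ in l2 *.
have m1 : Num.max 2 l <= 4 * l by rewrite ge_max; apply/andP; split; lra.
rewrite /hard_exponent -/l; have [pl|lp] := leP p l.
  by rewrite ge_min; apply/orP; left; lra.
by rewrite ge_min m1 orbT.
Qed.

(** For s >= ln d the factor d^(1/s) is at most e. *)
Lemma hard_exponent_norm p d (u : 'rV[R]_d) : 2 < p -> (2 <= d)%N ->
  lpnorm (hard_exponent p d) u <= 4 * lpnorm p u.
Proof.
move=> p2 d2; have p0 : 0 < p by apply: lt_trans p2.
have n0 := lpnorm_ge0 p u.
rewrite /hard_exponent; have [pm|mp] := leP p (Num.max 2 (ln d%:R)).
  by rewrite ler_peMl// ler1n.
set m := Num.max _ _; have m0 : 0 < m by rewrite lt_max ltr0n.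
apply: le_trans (lpnorm_le_sup m0 (fun i => coord_le_lpnorm u i p0)) _.
apply: ler_wpM2r => //; have d0 : (d%:R : R) != 0 by rewrite pnatr_eq0; case: (d) d2.
rewrite /powR (negbTE d0); apply: le_trans expR1_le4; rewrite ler_expR.
by rewrite mulrC ler_pdivrMr// mul1r le_max lexx orbT.
Qed.

Section instance_parameters.
Variables (p s L r : R) (d T : nat).
Hypotheses (p2 : 2 < p) (s2 : 2 <= s) (L0 : 0 < L) (r0 : 0 < r).
Hypotheses (T1 : (1 <= T)%N) (Td : (T <= d)%N).
Hypotheses (sp : forall u : 'rV[R]_d, lpnorm s u <= 4 * lpnorm p u).

Let p0 : 0 < p. Proof. exact: lt_trans p2. Qed.
Let p1 : 1 < p. Proof. by apply: lt_trans p2; rewrite ltr1n. Qed.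
Let s1 : 1 < s. Proof. by apply: lt_le_trans s2; rewrite ltr1n. Qed.
Let sB : 0 < s - 1. Proof. by rewrite subr_gt0. Qed.

(** The l_p norm of the shifts T, T-1, ..., 1; dividing r by it puts the
    minimizers at distance exactly r. *)
Definition staircase : R := (\sum_(n < T) (T - n)%:R `^ p) `^ p^-1.
Definition stair_step : R := r / staircase.
(** Makes the Lipschitz constant of [hard_admissible] equal to L for the
    penalty c = stair_step / 4. *)
Definition hard_scale : R := L * (stair_step / 4) / (128 * (s - 1)).

Lemma staircase_gt0 : 0 < staircase.
Proof.
rewrite powR_gt0// (bigD1 (Ordinal T1))//= subn0 ltr_pwDl//.
  by rewrite powR_gt0// ltr0n.
by apply: sumr_ge0 => i _; exact: powR_ge0.
Qed.

Lemma staircase_le : staircase <= T%:R * T%:R `^ p^-1.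
Proof.
have T0 : 0 <= T%:R :> R by exact: ler0n.
rewrite -(ler_powR2 p0) ?powR_ge0 ?mulr_ge0 ?powR_ge0//.
rewrite powRVK ?gt_eqF//; last by apply: sumr_ge0 => i _; exact: powR_ge0.
rewrite powRM ?powR_ge0// powRVK ?gt_eqF//.
apply: (@le_trans _ _ (\sum_(n < T) T%:R `^ p)).
  apply: ler_sum => i _; apply: ge0_ler_powR; rewrite ?nnegrE ?ler0n// ?ler_nat ?leq_subr//.
  exact: ltW.
by rewrite sumr_const card_ord mulr_natr.
Qed.

Lemma stair_step_gt0 : 0 < stair_step. Proof. by rewrite divr_gt0// staircase_gt0. Qed.
Let quarter_step_gt0 : 0 < stair_step / 4. Proof. by rewrite divr_gt0// stair_step_gt0. Qed.

Lemma hard_scale_gt0 : 0 < hard_scale.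
Proof. by apply: divr_gt0; apply: mulr_gt0; rewrite ?ltr0n. Qed.

Lemma stair_step_separates : stair_step / 4 * conjugate_exponent s < stair_step.
Proof.
have := conj_exp_le2 s2; have := stair_step_gt0; move: stair_step (conjugate_exponent s) => g q g0 q2.
by apply: (@le_lt_trans _ _ (g / 4 * 2)); [rewrite ler_wpM2l// divr_ge0// ltW | lra].
Qed.

Lemma sum_over_pattern (sigma : seq 'I_d) (F : nat -> R) : uniq sigma -> size sigma = T ->
  \sum_(j < d) (if j \in sigma then F (index j sigma) else 0) = \sum_(n < T) F n.
Proof.
move=> us ss; rewrite -big_mkcond /= -(big_uniq _ us) /=.
case: sigma us ss => [|j0 sigma'] us ss; first by move: T1; rewrite -ss.
set sigma := j0 :: sigma' in us ss *.
rewrite (big_nth j0) ss big_mkord; apply: eq_bigr => n _.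
by rewrite index_uniq// ss.
Qed.

Lemma pattern_shift_norm (pi : seq ('I_d * bool)) : uniq (unzip1 pi) -> size pi = T ->
  lpnorm p (pattern_shift T stair_step pi) = r.
Proof.
move=> upi sz; have g0 := stair_step_gt0.
have -> : lpnorm p (pattern_shift T stair_step pi) = stair_step * staircase.
  rewrite /lpnorm /staircase -[in RHS](@powRK _ stair_step p) ?(ltW g0) ?gt_eqF//.
  rewrite -powRM ?powR_ge0//; last by apply: sumr_ge0 => i _; exact: powR_ge0.
  congr (_ `^ _).
  rewrite -(@sum_over_pattern (unzip1 pi) (fun n => (T - n)%:R `^ p)) ?size_map// mulr_sumr.
  apply: eq_bigr => j _; rewrite mxE; case: ifP => _; last by rewrite normr0 powR0 ?mulr0// gt_eqF.
  by rewrite normrM (ger0_norm (ltW g0)) ger0_norm ?ler0n// powRM ?ler0n ?(ltW g0)// mulrC.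
by rewrite /stair_step divfK// gt_eqF// staircase_gt0.
Qed.

Lemma sign_sign_shift (pi : seq ('I_d * bool)) j :
  pattern_sign R pi 0 j * (pattern_sign R pi 0 j * pattern_shift T stair_step pi 0 j) =
  pattern_shift T stair_step pi 0 j.
Proof.
rewrite mulrA !mxE; case: ifP => _; last by rewrite mulr0.
by rewrite -expr2 sqrr_sign mul1r.
Qed.

(** At a covered point the weights have total mass 1 and live on the T
    revealed coordinates. Hölder's inequality against the indicator of these
    coordinates gives the factor T^(-1/p), and the scale and the bound on the
    staircase give the rest. *)
Lemma gradient_lower_bound (x0 x : 'rV[R]_d) (pi : seq ('I_d * bool)) n :
  uniq (unzip1 pi) -> size pi = T -> covers x0 pi n x ->
  gradient_floor (s - 1) p L r T <=
    lpnorm (conjugate_exponent p)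
      (gradient (pattern_function T s (stair_step / 4) hard_scale stair_step x0 pi) x).
Proof.
move=> upi sz [nT hcov].
have T0 : 0 < T%:R :> R by rewrite ltr0n.
have g0 := stair_step_gt0; have k0 := hard_scale_gt0; have S0 := staircase_gt0.
have -> : gradient (pattern_function T s (stair_step / 4) hard_scale stair_step x0 pi) x =
    hard_gradient s (stair_step / 4) hard_scale x0 (pattern_sign R pi) (pattern_shift T stair_step pi) x.
  exact: (gradient_hard x0 _ s2 quarter_step_gt0 k0 (pattern_sign_le1 R pi)).
set y := activation x0 (pattern_sign R pi) (pattern_shift T stair_step pi) x.
have aE k : y 0 k = pattern_sign R pi 0 k * (x - x0) 0 k + pattern_shift T stair_step pi 0 k.
  by rewrite !mxE.
have [i iin ix] : exists2 i, i \in unzip1 pi & index i (unzip1 pi) = n.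
  have nu : (n < size (unzip1 pi))%N by rewrite size_map.
  case E : (unzip1 pi) nu upi => [//|j0 w] nu upi.
  by exists (nth j0 (j0 :: w) n); [exact: mem_nth | exact: index_uniq].
have [h1 _] := hcov i ix.
have yi : stair_step <= y 0 i.
  rewrite aE h1 -[leLHS]add0r; apply: lerD => //.
  rewrite mxE iin ix; apply: ler_peMl; first exact: ltW.
  by rewrite ler1n subn_gt0 -sz.
have gs := lt_le_trans stair_step_separates yi.
have mass := smax_arg_mass s2 quarter_step_gt0 gs.
have lam0 k : k \notin unzip1 pi -> smax_arg s (stair_step / 4) y 0 k = 0.
  move=> kpi; apply: (smax_arg_eq0 s2 quarter_step_gt0 (i := i)).
  have yk : y 0 k = 0 by rewrite aE !mxE (negbTE kpi) mul0r addr0.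
  by rewrite yk subr0.
have lamge k : 0 <= smax_arg s (stair_step / 4) y 0 k by exact: smax_arg_ge0.
pose ind : 'rV[R]_d := \row_k (k \in unzip1 pi)%:R.
set g := hard_gradient _ _ _ _ _ _ _.
have gk k : `|g 0 k| * `|ind 0 k| = hard_scale * smax_arg s (stair_step / 4) y 0 k.
  rewrite [ind 0 k]mxE /g /hard_gradient -/y !mxE.
  have [kpi|kpi] := boolP (k \in unzip1 pi); last by rewrite (lam0 k kpi) normr0 !mulr0.
  by rewrite normr1 mulr1 normrM (gtr0_norm k0) normrM normrX normrN1 expr1n mul1r (ger0_norm (lamge k)).
have hh := hoelder_dotr g ind p1.
have indn : lpnorm p ind = T%:R `^ p^-1.
  rewrite /lpnorm; congr (_ `^ _).
  have -> : T%:R = \sum_(n < T) (1 : R) by rewrite sumr_const card_ord.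
  rewrite -(@sum_over_pattern (unzip1 pi) (fun=> 1)) ?size_map//.
  apply: eq_bigr => k _; rewrite mxE; case: (k \in _); rewrite ?normr1 ?powR1//.
  by rewrite normr0 powR0 ?gt_eqF.
move: hh; under eq_bigr do rewrite gk.
rewrite -mulr_sumr mass mulr1 indn => hh.
have tp : 0 < T%:R `^ p^-1 :> R by rewrite powR_gt0.
rewrite -(ler_pM2r tp); apply: le_trans hh.
rewrite /gradient_floor /hard_scale /stair_step.
have -> : T%:R `^ (1 + 2 / p) = T%:R * T%:R `^ p^-1 * T%:R `^ p^-1 :> R.
  have -> : 1 + 2 / p = 1 + p^-1 + p^-1 by ring.
  by rewrite !powRD ?(gt_eqF T0) ?implybT// powRr1// ltW.
have sl := staircase_le.
rewrite (_ : L * r / _ * _ = L * r / (512 * (s - 1)) * (T%:R * T%:R `^ p^-1)^-1); last first.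
  by field; rewrite !gt_eqF.
rewrite (_ : L * (r / staircase / 4) / (128 * (s - 1)) = L * r / (512 * (s - 1)) * staircase^-1); last first.
  by field; rewrite !gt_eqF.
apply: ler_wpM2l.
  by apply: ltW; apply: divr_gt0; apply: mulr_gt0; rewrite ?ltr0n.
rewrite lef_pV2 ?posrE; [exact: sl | exact: mulr_gt0 | exact: S0].
Qed.

Lemma resisting_instance (x0 : 'rV[R]_d) (A : algorithm x0) :
  exists f : 'rV[R]_d -> R,
    [/\ admissible p L f, lpdist p x0 (argmin f) = r
      & forall x, x \in queries A f T ->
          gradient_floor (s - 1) p L r T <= lpnorm (conjugate_exponent p) (gradient f x)].
Proof.
have g0 := stair_step_gt0; have k0 := hard_scale_gt0.
have [pi [sz upi hc]] := adversary s2 quarter_step_gt0 k0 stair_step_separates A (leqnn T) Td.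
have h0 j : 0 <= pattern_shift T stair_step pi 0 j.
  by rewrite mxE; case: ifP => // _; rewrite mulr_ge0// ltW.
exists (pattern_function T s (stair_step / 4) hard_scale stair_step x0 pi); split.
- apply: (hard_admissible x0 s2 quarter_step_gt0 k0 p2 sp (pattern_sign_le1 R pi) (sign_sign_shift pi)).
  rewrite /hard_scale le_eqVlt; apply/orP; left; apply/eqP.
  by field; rewrite !gt_eqF.
- rewrite (hard_lpdist x0 s2 quarter_step_gt0 k0 p2 (pattern_sign_le1 R pi) h0 (sign_sign_shift pi)).
  exact: pattern_shift_norm.
- move=> x /(nthP 0)[n nq <-]; exact: gradient_lower_bound (hc n nq).
Qed.

End instance_parameters.
End lower_bound.

(** * Complexity *)

Section complexity_bounds.
Variable R : realType.

Definition hard_constant (p : R) (d : nat) : R := hard_exponent p d - 1.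

Lemma hard_constant_gt0 p d : 2 < p -> 0 < hard_constant p d.
Proof. by move=> p2; rewrite subr_gt0 (lt_le_trans _ (hard_exponent_ge2 d p2))// ltr1n. Qed.

Lemma min_ln_gt0 (p : R) d : 2 < p -> (2 <= d)%N -> 0 < Num.min p (ln d%:R).
Proof.
move=> p2 d2; rewrite lt_min (lt_trans _ p2)//=.
by apply: lt_le_trans (ln_nat_ge_half R d2); rewrite invr_gt0.
Qed.

Lemma hard_constant_le (p : R) d : 2 < p -> (2 <= d)%N ->
  hard_constant p d <= 4 * Num.min p (ln d%:R).
Proof.
by move=> p2 d2; apply: le_trans (hard_exponent_le p2 d2); rewrite gerBl.
Qed.

Lemma hard_objective (p : R) d (L r : R) (x0 : 'rV[R]_d) T (A : algorithm x0) :
  2 < p -> (2 <= d)%N -> 0 < L -> 0 < r -> (1 <= T)%N -> (T <= d)%N ->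
  exists f : 'rV[R]_d -> R,
    [/\ admissible p L f, lpdist p x0 (argmin f) = r
      & forall x, x \in queries A f T ->
          gradient_floor (hard_constant p d) p L r T
            <= lpnorm (conjugate_exponent p) (gradient f x)].
Proof.
move=> p2 d2 L0 r0 T1 Td.
apply: (@resisting_instance R p (hard_exponent p d) L r d T) => //.
  exact: hard_exponent_ge2.
by move=> u; exact: hard_exponent_norm.
Qed.

Lemma rate_exponent (p : R) : 2 < p -> 0 < p / (p + 2) <= 1.
Proof.
move=> p2; have p0 : 0 < p by apply: lt_trans p2.
by rewrite divr_gt0 ?addr_gt0//= ler_pdivrMr ?addr_gt0// mul1r lerDl.
Qed.

(** The floor at t is inverted by raising it to the power p/(p+2); since the
    constants are below 1 and this exponent is at most 1, they may be left
    outside the power. *)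
Lemma horizon_of_floor (k M m K eps p t : R) : 1 <= k -> 0 < M -> 0 < m -> M <= 4 * m ->
  0 < K -> 0 < eps -> 2 < p -> 0 < t -> K / (k * M * t `^ (1 + 2 / p)) <= eps ->
  (k * 4)^-1 * (K / (eps * m)) `^ (p / (p + 2)) <= t.
Proof.
move=> k1 M0 m0 Mm K0 e0 p2 t0 hfl.
have k0 : 0 < k by apply: lt_le_trans k1.
have p0 : 0 < p by apply: lt_trans p2.
have /andP[a0 a1] := rate_exponent p2.
set a := p / (p + 2) in a0 a1 *.
have tp : 0 < t `^ (1 + 2 / p) by rewrite powR_gt0.
have ki : 0 < (k * 4)^-1 by rewrite invr_gt0 mulr_gt0.
have X0 : 0 < K / (eps * m) by apply: divr_gt0 => //; apply: mulr_gt0.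
have h1 : (k * 4)^-1 * (K / (eps * m)) <= t `^ (1 + 2 / p).
  move: hfl; rewrite ler_pdivrMr ?mulr_gt0// => h.
  have -> : (k * 4)^-1 * (K / (eps * m)) = K / (eps * (k * (4 * m))).
    by field; rewrite !gt_eqF.
  rewrite ler_pdivrMr ?mulr_gt0//; apply: le_trans h _.
  have -> : t `^ (1 + 2 / p) * (eps * (k * (4 * m))) = eps * (k * (4 * m) * t `^ (1 + 2 / p)) by ring.
  by rewrite (ler_pM2l e0) (ler_pM2r tp) (ler_pM2l k0).
have h2 : ((k * 4)^-1 * (K / (eps * m))) `^ a <= t.
  have -> : t = (t `^ (1 + 2 / p)) `^ a.
    rewrite -powRrM (_ : (1 + 2 / p) * a = 1) ?powRr1 ?(ltW t0)//.
    by rewrite /a; field; rewrite !gt_eqF// addr_gt0.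
  apply: ge0_ler_powR; rewrite ?nnegrE ?(ltW a0)//; last exact: powR_ge0.
  by apply: mulr_ge0; exact: ltW.
apply: le_trans h2; rewrite [leRHS]powRM ?(ltW ki) ?(ltW X0)//; apply: ler_wpM2r; first exact: powR_ge0.
apply: (@le_trans _ _ ((k * 4)^-1 `^ 1)); first by rewrite powRr1// ltW.
apply: ger_powR => //; rewrite ki /= invf_le1 ?mulr_gt0//.
by move: k1; clear; lra.
Qed.

Lemma selected_horizon_ge (p : R) d (L r eps : R) T : 2 < p -> (2 <= d)%N ->
  0 < L -> 0 < r -> 0 < eps ->
  selected_horizon (hard_constant p d) p L r eps T ->
  (512 * 4)^-1 * (L * r / (eps * Num.min p (ln d%:R))) `^ (p / (p + 2)) <= T.+1%:R.
Proof.
move=> p2 d2 L0 r0 e0 [T1 _ Tmax].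
have hfl : gradient_floor (hard_constant p d) p L r T.+1 <= eps.
  by rewrite leNgt; apply/negP => h; have := Tmax T.+1 isT h; rewrite ltnn.
have T0 : 0 < T.+1%:R :> R by rewrite ltr0n.
have k1 : 1 <= 512 :> R by rewrite ler1n.
exact: (horizon_of_floor k1 (hard_constant_gt0 d p2) (min_ln_gt0 p2 d2)
  (hard_constant_le p2 d2) (mulr_gt0 L0 r0) e0 p2 T0 hfl).
Qed.

(** None of the first T queries reaches eps, so at least T + 1 are needed, and
    T + 1 fails the inequality that defines the horizon. *)
Lemma worst_case_ge (p : R) d (L r eps : R) (x0 : 'rV[R]_d) T (A : algorithm x0) :
  2 < p -> (2 <= d)%N -> 0 < L -> 0 < r -> 0 < eps ->
  selected_horizon (hard_constant p d) p L r eps T -> (T <= d)%N ->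
  (((512 * 4)^-1 * (L * r / (eps * Num.min p (ln d%:R))) `^ (p / (p + 2)))%:E
     <= worst_case A p eps (objectives_eq p L r x0))%E.
Proof.
move=> p2 d2 L0 r0 e0 hT Td; have [T1 floorT _] := hT.
have [f [adm dist hq]] := hard_objective A p2 d2 L0 r0 T1 Td.
apply: (@le_trans _ _ (queries_needed A p eps f)); last first.
  by apply: ereal_sup_ubound; exists f.
apply: le_ereal_inf_tmp => _ [n [x xn gx] <-]; rewrite lee_fin.
apply: le_trans (selected_horizon_ge p2 d2 L0 r0 e0 hT) _; rewrite ler_nat ltnNge.
apply/negP => nT; have := hq x (queries_sub nT xn).
by rewrite leNgt (le_lt_trans gx floorT).
Qed.

Lemma queries_needed_le (p eps : R) d (x0 : 'rV[R]_d) (A : algorithm x0) f n xhat :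
  returns A f n xhat -> lpnorm (conjugate_exponent p) (gradient f xhat) <= eps ->
  (queries_needed A p eps f <= n%:R%:E)%E.
Proof.
move=> [_ [i [_ ->]]] gx; apply: ereal_inf_lbound.
exists n => //; exists (nth 0 (queries A f n) i) => //.
apply: mem_nth; rewrite -(size_map (oracle f)); exact: ltn_ord.
Qed.

(** The ratio of min(p, ln d) to p lies between 1/3 and 1, so that it only
    changes constants depending on p. *)
Lemma matching_rates (c Cp p : R) : 0 < c -> 2 < p ->
  (forall d (L r eps : R) (x0 : 'rV[R]_d) T (A : algorithm x0),
    (2 <= d)%N -> 0 < L -> 0 < r -> 0 < eps ->
    selected_horizon (hard_constant p d) p L r eps T -> (T <= d)%N ->
    ((c * (L * r / (eps * Num.min p (ln d%:R))) `^ (p / (p + 2)))%:E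
       <= worst_case A p eps (objectives_eq p L r x0))%E) ->
  (forall d (L r eps : R) (x0 : 'rV[R]_d), 0 < L -> 0 < r -> 0 < eps ->
    exists A : algorithm x0, forall f : 'rV[R]_d -> R,
      admissible p L f -> lpdist p x0 (argmin f) <= r ->
      exists (n : nat) (xhat : 'rV[R]_d),
        [/\ returns A f n xhat,
            lpnorm (conjugate_exponent p) (gradient f xhat) <= eps
          & n%:R <= Cp * (1 + (L * r / eps) `^ (p / (p + 2)))]) ->
  exists k1 k2 : R,
    [/\ 0 < k1, 0 < k2 &
      forall (d : nat) (L r eps : R) (x0 : 'rV[R]_d) (T : nat),
        (2 <= d)%N -> 0 < L -> 0 < r -> 0 < eps ->
        selected_horizon (hard_constant p d) p L r eps T -> (T <= d)%N ->
        p <= 3 * ln d%:R ->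
        let K := L * r / eps in
        let a := p / (p + 2) in
        [/\ k1 * K `^ a <= c * (L * r / (eps * Num.min p (ln d%:R))) `^ a,
            c * (L * r / (eps * Num.min p (ln d%:R))) `^ a <= k2 * K `^ a,
            ((k1 * K `^ a)%:E <= complexity x0 p eps (objectives_eq p L r x0))%E
          & (complexity x0 p eps (objectives_le p L r x0)
               <= (k2 * (1 + K `^ a))%:E)%E]].
Proof.
move=> c0 p2 lower upper.
have p0 : 0 < p by apply: lt_trans p2.
have /andP[a0 a1] := rate_exponent p2.
set a := p / (p + 2) in a0 a1 lower upper *.
have p3 : 0 < 3 / p by rewrite divr_gt0.
exists (c * p^-1 `^ a), (c * (3 / p) `^ a + `|Cp|); split.
- by rewrite mulr_gt0// powR_gt0// invr_gt0.
- by rewrite ltr_pwDl// mulr_gt0// powR_gt0.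
move=> d L r eps x0 T d2 L0 r0 e0 hT Td pd K a'.
have m0 := min_ln_gt0 p2 d2; set m := Num.min p (ln d%:R) in m0 *.
have K0 : 0 < K by rewrite /K; apply: divr_gt0 => //; exact: mulr_gt0.
have mE : L * r / (eps * m) = m^-1 * K by rewrite /K; field; rewrite !gt_eqF.
have mp : m <= p by rewrite /m ge_min lexx.
have pm : p <= 3 * m.
  by rewrite /m; have [_|_] := leP p (ln d%:R) => //; have := p0; lra.
have h1 : c * p^-1 `^ a * K `^ a <= c * (L * r / (eps * m)) `^ a.
  rewrite mE [(m^-1 * K) `^ a]powRM ?invr_ge0 ?(ltW m0) ?(ltW K0)// -[leLHS]mulrA.
  apply: ler_wpM2l; first exact: ltW.
  apply: ler_wpM2r; first exact: powR_ge0.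
  apply: ge0_ler_powR; rewrite ?nnegrE ?invr_ge0 ?(ltW a0) ?(ltW m0) ?(ltW p0)//.
  by rewrite lef_pV2 ?posrE.
split => //.
- rewrite mulrDl; apply: (@le_trans _ _ (c * (3 / p) `^ a * K `^ a)); last first.
    by rewrite lerDl mulr_ge0// powR_ge0.
  rewrite mE [(m^-1 * K) `^ a]powRM ?invr_ge0 ?(ltW m0) ?(ltW K0)// -[leRHS]mulrA.
  apply: ler_wpM2l; first exact: ltW.
  apply: ler_wpM2r; first exact: powR_ge0.
  apply: ge0_ler_powR; rewrite ?nnegrE ?invr_ge0 ?(ltW a0) ?(ltW m0) ?(ltW p3)//.
  by rewrite -[leLHS]mul1r ler_pdivrMr// mulrAC ler_pdivlMr// mul1r.
- apply: le_ereal_inf_tmp => _ [A _ <-].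
  by apply: le_trans (lower _ _ _ _ _ _ A d2 L0 r0 e0 hT Td); rewrite lee_fin.
have [A HA] := upper d L r eps x0 L0 r0 e0.
apply: (@le_trans _ _ (worst_case A p eps (objectives_le p L r x0))).
  by apply: ereal_inf_lbound; exists A.
apply: ge_ereal_sup => _ [f [adm hd] <-].
have [n [xhat [ret gx hn]]] := HA f adm hd.
apply: le_trans (queries_needed_le ret gx) _; rewrite lee_fin.
apply: le_trans hn _; apply: ler_wpM2r; first by rewrite addr_ge0 ?powR_ge0.
by apply: le_trans (ler_norm _) _; rewrite lerDr mulr_ge0 ?(ltW c0)// powR_ge0.
Qed.

End complexity_bounds.
Theorem proposition2p2 (R : realType) :
  (forall p : R, 2 < p -> exists Cp : R,
     forall (d : nat) (L r eps : R) (x0 : 'rV[R]_d),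
       0 < L -> 0 < r -> 0 < eps ->
       exists A : algorithm x0,
         forall f : 'rV[R]_d -> R,
           admissible p L f -> lpdist p x0 (argmin f) <= r ->
           exists (n : nat) (xhat : 'rV[R]_d),
             [/\ returns A f n xhat,
                 lpnorm (conjugate_exponent p) (gradient f xhat) <= eps
               & n%:R <= Cp * (1 + (L * r / eps) `^ (p / (p + 2)))])
  /\
  (exists (C : R) (M : R -> nat -> R) (c : R),
     [/\ forall (p : R) (d : nat), 2 < p -> (2 <= d)%N ->
           0 < M p d /\ M p d <= C * Num.min p (ln d%:R),
         forall (p : R) (d : nat) (L r : R) (x0 : 'rV[R]_d) (T : nat)
                (A : algorithm x0),
           2 < p -> (2 <= d)%N -> 0 < L -> 0 < r ->
           (1 <= T)%N -> (T <= d)%N ->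
           exists f : 'rV[R]_d -> R,
             [/\ admissible p L f,
                 lpdist p x0 (argmin f) = r
               & forall x, x \in queries A f T ->
                   gradient_floor (M p d) p L r T
                     <= lpnorm (conjugate_exponent p) (gradient f x)],
         0 < c /\
         forall (p : R) (d : nat) (L r eps : R) (x0 : 'rV[R]_d) (T : nat)
                (A : algorithm x0),
           2 < p -> (2 <= d)%N -> 0 < L -> 0 < r -> 0 < eps ->
           selected_horizon (M p d) p L r eps T -> (T <= d)%N ->
           ((c * (L * r / (eps * Num.min p (ln d%:R))) `^ (p / (p + 2)))%:E
              <= worst_case A p eps (objectives_eq p L r x0))%E
       & forall p : R, 2 < p -> exists k1 k2 : R,
           [/\ 0 < k1, 0 < k2 &
             forall (d : nat) (L r eps : R) (x0 : 'rV[R]_d) (T : nat),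
               (2 <= d)%N -> 0 < L -> 0 < r -> 0 < eps ->
               selected_horizon (M p d) p L r eps T -> (T <= d)%N ->
               p <= 3 * ln d%:R ->
               let K := L * r / eps in
               let a := p / (p + 2) in
               [/\ k1 * K `^ a
                     <= c * (L * r / (eps * Num.min p (ln d%:R))) `^ a,
                   c * (L * r / (eps * Num.min p (ln d%:R))) `^ a
                     <= k2 * K `^ a,
                   ((k1 * K `^ a)%:E
                      <= complexity x0 p eps (objectives_eq p L r x0))%E
                 & (complexity x0 p eps (objectives_le p L r x0)
                      <= (k2 * (1 + K `^ a))%:E)%E]]]).

Proof.
split; first exact: upper_bound.
exists 4, (@hard_constant R), (512 * 4)^-1; split.
- by move=> p d p2 d2; split; [exact: hard_constant_gt0 | exact: hard_constant_le].
- by move=> *; exact: hard_objective.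
- split; first by rewrite invr_gt0; apply: mulr_gt0; rewrite ltr0n.
  move=> p d L r eps x0 T A p2 d2 L0 r0 e0 hT Td.
  exact: worst_case_ge p2 d2 L0 r0 e0 hT Td.
move=> p p2; have [Cp upper] := upper_bound p2.
apply: (matching_rates _ p2 _ upper).
  by rewrite invr_gt0; apply: mulr_gt0; rewrite ltr0n.
move=> d L r eps x0 T A d2 L0 r0 e0 hT Td.
exact: worst_case_ge p2 d2 L0 r0 e0 hT Td.
Qed.
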